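(* Let $0<p\le 1\le q\le\infty$ and $p<q$. If $f\in H^{p,q,0}(\mathbf{R}^+)$ (and $f$ is not identically zero), then $$\|Hf\|_{L^p(\mathbf{R}^+)}<\frac{1}{(1-p/q)^{1/p}}\,\|f\|_{H^{p,q,0}(\mathbf{R}^+)} .$$
   Context: $\mathbf{R}^+=(0,\infty)$. Hardy operator: $Hf(x)=\frac1x\int_0^x f(t)\,dt$ for $x>0$. $\|g\|_{L^p(\mathbf{R}^+)}=\left(\int_0^\infty|g(x)|^p\,dx\right)^{1/p}$, also for $p<1$. When $q=\infty$, $p/q$ and $1/q$ mean $0$. For $0<p\le1\le q\le\infty$, $p<q$, a $(p,q,0)$-atom is a function $a$ on $\mathbf{R}^+$ such that for some $0<x_0<x_1<\infty$: (i) $\operatorname{supp} a\subset(x_0,x_1)$; (ii) $\|a\|_{L^q(\mathbf{R}^+)}\le (x_1-x_0)^{1/q-1/p}$; (iii) $\int_0^\infty a(x)\,dx=0$. $H^{p,q,0}(\mathbf{R}^+)$ is the set of all $f=\sum_{k=1}^\infty\lambda_k a_k$, where each $a_k$ is a $(p,q,0)$-atom, $\sum_k|\lambda_k|^p<\infty$, and the series converges in the sense of distributions. Its quasinorm is $\|f\|_{H^{p,q,0}(\mathbf{R}^+)}=\inf\left(\sum_k|\lambda_k|^p\right)^{1/p}$, the infimum being over all such decompositions of $f$. For $f=\sum_k\lambda_k a_k\in H^{p,q,0}(\mathbf{R}^+)$, $Hf$ is understood as the function $Hf(x)=\sum_k\lambda_k Ha_k(x)$ for a.e. $x>0$. Standing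 convention: all functions are assumed not identically zero.
   Formalization: Hf is required to equal the sum of λ_k Ha_k a.e. for every atomic decomposition of f; for p<1/2 this sum always depends on the decomposition, so Hf is undefined there and the theorem has content only for 1/2≤p≤1. *)

(* Defs.v *)
(* MathComp-Analysis. *)
From HB Require Import structures.
From mathcomp Require Import all_boot all_order all_algebra.
From mathcomp Require Import all_classical all_reals all_analysis.

Set Implicit Arguments.
Unset Strict Implicit.
Unset Printing Implicit Defensive.

Import Order.TTheory GRing.Theory Num.Theory.
Import numFieldNormedType.Exports.

Local Open Scope classical_set_scope.
Local Open Scope ring_scope.

(* Functions on (0, oo) are total functions R -> R whose values outside (0, oo)
   are never used; Lebesgue classes are represented by Borel functions. *)
Definition Rpos (R : realType) : set R := `]0, +oo[.

(* For 0 < r < 1 this is the usual quasinorm (\int |g|^r)^(1/r). *)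
Definition LnormRpos (R : realType) (r : \bar R) (g : R -> R) : \bar R :=
  Lnorm (@lebesgue_measure R) r ((EFin \o g) \_ (@Rpos R)).

(* 1/q, with 1/oo = 0 *)
Definition inv_exponent (R : realType) (q : \bar R) : R := fine (q^-1)%E.

Definition support_pos (R : realType) (g : R -> R) : set R :=
  closure [set x | Rpos x /\ g x != 0].

Definition hardy (R : realType) (g : R -> R) (x : R) : R :=
  x^-1 * \int[@lebesgue_measure R]_(t in `]0, x[) g t.

Definition is_atom (R : realType) (p : R) (q : \bar R) (a : R -> R) : Prop :=
  measurable_fun (@Rpos R) a /\
  exists x0 x1 : R, [/\ 0 < x0 < x1,
    support_pos a `<=` `]x0, x1[,
    (LnormRpos q a <= ((x1 - x0) `^ (inv_exponent q - p^-1))%:E)%E &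
    \int[@lebesgue_measure R]_(x in @Rpos R) a x = 0].

(* C_c^oo (0, oo), each function being extended by 0 to R *)
Definition test_function (R : realType) (phi : R -> R) : Prop :=
  [/\ forall (n : nat) (x : R), derivable (derive1n n phi) x 1,
      compact (closure [set x | phi x != 0]) &
      closure [set x | phi x != 0] `<=` @Rpos R].

Definition pairing (R : realType) (a phi : R -> R) : R :=
  \int[@lebesgue_measure R]_(x in @Rpos R) (a x * phi x).

(* The elements of H^{p,q,0} need not be functions when p < 1: f is a
   functional on test functions, of which only the values on C_c^oo (0, oo)
   matter.  A pointwise limit of distributions is a distribution, so linearity
   and continuity of f follow from the last clause. *)
Definition atomic_decomposition (R : realType) (p : R) (q : \bar R)
    (f : (R -> R) -> R) (lam : nat -> R) (a : nat -> R -> R) : Prop :=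
  [/\ forall k, is_atom p q (a k),
      (\sum_(0 <= k <oo) (`|lam k| `^ p)%:E < +oo)%E &
      forall phi, test_function phi ->
        series (fun k => lam k * pairing (a k) phi) @ \oo --> f phi].

Definition in_Hpq0 (R : realType) (p : R) (q : \bar R)
    (f : (R -> R) -> R) : Prop :=
  exists lam a, atomic_decomposition p q f lam a.

Definition Hpq0_norm (R : realType) (p : R) (q : \bar R)
    (f : (R -> R) -> R) : \bar R :=
  ereal_inf [set s | exists lam a, atomic_decomposition p q f lam a /\
    s = poweR (\sum_(0 <= k <oo) (`|lam k| `^ p)%:E)%E p^-1].

Definition nonzero_distribution (R : realType) (f : (R -> R) -> R) : Prop :=
  exists2 phi, test_function phi & f phi != 0.

(* "Hf = h": h is a.e. equal to the sum of lam_k H a_k.  Since f does not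
   determine (lam, a), this is required of every decomposition of f. *)
Definition is_hardy_transform (R : realType) (p : R) (q : \bar R)
    (f : (R -> R) -> R) (h : R -> R) : Prop :=
  measurable_fun (@Rpos R) h /\
  forall lam a, atomic_decomposition p q f lam a ->
    {ae @lebesgue_measure R, forall x, 0 < x ->
      series (fun k => lam k * hardy (a k) x) @ \oo --> h x}.

(* Main.v *)
(* Let [a] be an atom supported in [(x0, x1)], [L = x1 - x0] and [y = x - x0].
   Hoelder's inequality on [(x0, x)] gives [|H a x| <= y^(-1/q) L^(1/q - 1/p)],
   whose p-th power has integral exactly [1 / (1 - p/q)] over [0 < y < L].  The
   cancellation of [a] also gives [|H a x| <= L^(1 - 1/p) / (2 y)], which is smaller
   by a fixed factor for [y > 3 L / 4].  So [\int |H a|^p] is at most a constant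
   [K < 1 / (1 - p/q)] that is the same for all atoms.  Since [t^p] is
   subadditive, [\int |H f|^p <= K \sum |lam_k|^p] for every decomposition, and
   the inequality stays strict after taking the infimum, provided that the
   quasinorm of [f] is not 0.

   If [p >= 1/2], the pairings of all atoms with a test function are bounded, so
   the quasinorm of a nonzero distribution is positive.  If [p < 1/2], the
   quasinorm may vanish, but then no [h] is the transform of [f] for all
   decompositions: a spike of mass m and width w costs about
   [m^p w^(1 - 2p)], which tends to 0 with w, so that a fixed bump can be
   split along a binary tree into ever narrower spikes at arbitrarily small cost.
   This gives a decomposition of the zero distribution whose Hardy series has a
   nonzero sum, and adding it to a decomposition of [f] changes [h]. *)
Require Import Defs.
From HB Require Import structures.
From mathcomp Require Import all_boot all_order all_algebra.
From mathcomp Require Import all_classical all_reals all_analysis measurable_realfun ess_sup_inf.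
From mathcomp Require Import ring lra zify.
Import Order.TTheory GRing.Theory Num.Theory.
Import numFieldNormedType.Exports.
Set Implicit Arguments.
Unset Strict Implicit.
Unset Printing Implicit Defensive.
Local Open Scope classical_set_scope.
Local Open Scope ring_scope.

(** * Hölder's inequality on subsets of the half-line *)

Section holder.
Context {R : realType}.
Notation mu := (@lebesgue_measure R).
Implicit Types (a : R -> R) (q : \bar R).

Lemma inv_exponent_ge0_le1 q : (1 <= q)%E -> 0 <= inv_exponent q <= 1.
Proof.
rewrite /inv_exponent; case: q => [r||]//.
  rewrite lee_fin => r1; have r0 : 0 < r by exact: lt_le_trans r1.
  by rewrite inver gt_eqF//= invr_ge0 (ltW r0) invf_le1.
by rewrite invey /= lexx ler01.
Qed.

Lemma measurable_Rpos : measurable (@Rpos R).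
Proof. exact: measurable_itv. Qed.

Lemma LnormRpos_restrict q a : LnormRpos q a = Lnorm mu q (EFin \o (a \_ (@Rpos R))).
Proof. by rewrite /LnormRpos restrict_EFin. Qed.

Lemma lebesgue_measure_setT_gt0 : (0 < mu [set: R])%E.
Proof.
apply: (@lt_le_trans _ _ (mu `[0, 1])).
  by rewrite lebesgue_measure_itv/= lte_fin ltr01 sube0 lte_fin.
by apply: le_measure; rewrite ?inE.
Qed.

(** Hölder against the indicator of [E], whose conjugate norm is [m] to the power [1 - 1/q]. The
    endpoint exponents are treated apart: 1 by monotonicity of the integral, infinity by the
    essential supremum. *)
Lemma integral_le_LnormRpos q a (N m : R) (E : set R) :
  (1 <= q)%E -> measurable_fun (@Rpos R) a -> (LnormRpos q a <= N%:E)%E ->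
  measurable E -> E `<=` @Rpos R -> mu E = m%:E -> 0 < m ->
  (\int[mu]_(x in E) `|a x|%:E <= (m `^ (1 - inv_exponent q) * N)%:E)%E.
Proof.
move=> q1 ma aN mE ERpos muE m0.
have mf : measurable_fun [set: R] (a \_ (@Rpos R)).
  by apply/(measurable_restrictT _ _).1 => //; exact: measurable_Rpos.
move: aN; rewrite LnormRpos_restrict; set f := a \_ _ => aN.
have fE x : E x -> f x = a x.
  by move=> Ex; rewrite /f patchE mem_set//; exact: ERpos.
have intE : (\int[mu]_(x in E) `|a x|%:E = \int[mu]_x `|(f x * \1_E x)%:E|)%E.
  rewrite integral_mkcond; apply: eq_integral => x _.
  rewrite patchE indicE; case: ifPn => [|_] /=; last by rewrite mulr0 normr0.
  by move=> /set_mem Ex; rewrite mulr1 fE.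
case: q q1 aN => [r| |]// q1 aN.
- have [r1|rn1] := eqVneq r 1.
    rewrite /inv_exponent r1 inver oner_eq0/= invr1 subrr powRr0 mul1r intE.
    apply: le_trans aN; rewrite r1 Lnorm1.
    apply: ge0_le_integral => //.
    + apply: measurableT_comp => //; apply/measurable_EFinP.
      exact: measurable_funM.
    + by apply: measurableT_comp => //; apply/measurable_EFinP.
    + move=> x _; rewrite lee_fin normrM ler_piMr// indicE.
      by case: (_ \in _); rewrite ?normr1 ?normr0.
  have r_gt1 : 1 < r by rewrite lt_neqAle eq_sym rn1 -lee_fin.
  have r0 : 0 < r by exact: lt_trans r_gt1.
  pose r' := (1 - r^-1)^-1.
  have r'0 : 0 < r' by rewrite invr_gt0 subr_gt0 invf_lt1.
  have := @hoelder _ _ _ mu f (\1_E) r r' mf (measurable_indic mE) r0 r'0.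
  rewrite /r' invrK subrKC => /(_ erefl).
  rewrite Lnorm1 -/r' => hold.
  rewrite intE; apply: le_trans hold _.
  have -> : Lnorm mu r'%:E (EFin \o \1_E) = (m `^ (1 - r^-1))%:E.
    rewrite unlock -/r'.
    have -> : (\int[mu]_x (`| (EFin \o \1_E) x| `^ r') = \int[mu]_x (\1_E x)%:E)%E.
      apply: eq_integral => x _ /=; rewrite indicE; case: (_ \in _).
        by rewrite normr1 powR1.
      by rewrite normr0 powR0// gt_eqF.
    transitivity (mu E `^ r'^-1)%E; first by rewrite integral_indic// setIT.
    by rewrite muE poweR_EFin invrK.
  rewrite /inv_exponent inver gt_eqF//= muleC EFinM.
  by apply: lee_wpmul2l => //; rewrite lee_fin powR_ge0.
- have := aN; rewrite unlock ifT; last exact: lebesgue_measure_setT_gt0.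
  move=> /ess_supP faN.
  rewrite /inv_exponent invey/= subr0 powRr1 ?(ltW m0)//.
  have -> : (m * N)%:E = (\int[mu]_(x in E) (cst N%:E x))%E.
    transitivity (N%:E * mu E)%E; last by rewrite integral_cst.
    by rewrite muE -EFinM mulrC.
  apply: ae_ge0_le_integral => //.
  + apply/measurable_EFinP; apply: measurableT_comp => //.
    by apply: measurable_funS ma => //; exact: measurable_Rpos.
  + by move=> x _; exact: le_trans (Lnorm_ge0 _ _ _) aN.
  + apply: filterS faN => x /= + Ex; by rewrite fE.
Qed.

End holder.

(** * Atoms *)

Section atom.
Context {R : realType}.
Notation mu := (@lebesgue_measure R).

Lemma Rintegral_subset_eq0 (D E : set R) (g : R -> R) : E `<=` D ->
  (forall x, D x -> ~ E x -> g x = 0) ->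
  \int[mu]_(x in D) g x = \int[mu]_(x in E) g x.
Proof.
move=> ED g0; rewrite Rintegral_mkcond [RHS]Rintegral_mkcond.
apply: eq_Rintegral => x _; rewrite !patchE.
have [xE|xE] := boolP (x \in E); first by rewrite (mem_set (ED _ (set_mem xE))).
case: ifPn => // /set_mem Dx; apply: g0 => // Ex.
by move/negP: xE; apply; exact: mem_set.
Qed.

(** Trades the closed support for pointwise vanishing outside (x0, x1), the form used in the
    estimates. *)
Lemma is_atomP (p : R) q (a : R -> R) : is_atom p q a ->
  measurable_fun (@Rpos R) a /\
  exists x0 x1 : R, [/\ 0 < x0 < x1,
    forall x, 0 < x -> ~~ (x0 < x < x1) -> a x = 0,
    (LnormRpos q a <= ((x1 - x0) `^ (inv_exponent q - p^-1))%:E)%E &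
    \int[mu]_(x in @Rpos R) a x = 0].
Proof.
move=> [ma [x0 [x1 [x01 supp aN a0]]]]; split => //; exists x0, x1; split => //.
move=> x xgt0 xx01; apply/eqP/negP => /negP ax0.
have /supp : support_pos a x.
  by apply: subset_closure; split => //; rewrite /Rpos/= in_itv/= xgt0.
by rewrite /= in_itv/= (negbTE xx01).
Qed.

Context (p : R) (q : \bar R) (a : R -> R) (x0 x1 : R).
Context (q1 : (1 <= q)%E) (ma : measurable_fun (@Rpos R) a)
  (x0_gt0 : 0 < x0) (x01 : x0 < x1)
  (a_out : forall x, 0 < x -> ~~ (x0 < x < x1) -> a x = 0)
  (aN : (LnormRpos q a <= ((x1 - x0) `^ (inv_exponent q - p^-1))%:E)%E)
  (a0 : \int[mu]_(x in @Rpos R) a x = 0).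

Let i := inv_exponent q.
Let L := x1 - x0.
Let L0 : 0 < L. Proof. by rewrite subr_gt0. Qed.

Lemma integral_itv_atom_le c d : 0 <= c -> c < d ->
  (\int[mu]_(x in `]c, d[) `|a x|%:E <= ((d - c) `^ (1 - i) * L `^ (i - p^-1))%:E)%E.
Proof.
move=> c0 cd; apply: (integral_le_LnormRpos q1 ma aN) => //.
- by move=> x; rewrite /Rpos/= !in_itv/= => /andP[cx _]; rewrite andbT (le_lt_trans c0).
- by rewrite lebesgue_measure_itv/= lte_fin cd EFinB.
- by rewrite subr_gt0.
Qed.

Lemma atom_integrable : mu.-integrable (@Rpos R) (EFin \o a).
Proof.
apply/integrableP; split; first exact/measurable_EFinP.
rewrite (_ : integral _ _ _ = \int[mu]_(x in `]x0, x1[) `|a x|%:E)%E.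
  by apply: le_lt_trans (integral_itv_atom_le (ltW x0_gt0) x01) _; rewrite ltry.
rewrite integral_mkcond [RHS]integral_mkcond; apply: eq_integral => x _.
rewrite !patchE; case: ifPn => [|xR]; last first.
  rewrite ifF//; apply/negbTE; apply: contra xR => /set_mem/=.
  rewrite in_itv/= => /andP[x0x _]; apply/mem_set.
  by rewrite /Rpos/= in_itv/= andbT (lt_trans x0_gt0).
move=> /set_mem; rewrite /Rpos/= in_itv/= andbT => xgt0.
case: ifPn => // /negP xx; rewrite a_out ?normr0//.
by apply/negP => xx'; apply: xx; apply/mem_set; rewrite /= in_itv.
Qed.

Lemma atom_integrableS D : measurable D -> D `<=` @Rpos R ->
  mu.-integrable D (EFin \o a).
Proof.
by move=> mD DR; apply: integrableS atom_integrable => //; exact: measurable_Rpos.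
Qed.

Lemma atom_integrable_norm D : measurable D -> D `<=` @Rpos R ->
  mu.-integrable D (EFin \o (fun x => `|a x|)).
Proof. by move=> mD DR; apply: integrable_norm; exact: atom_integrableS. Qed.

Lemma Rintegral_itv_atom_le c d : 0 <= c -> c < d ->
  \int[mu]_(x in `]c, d[) `|a x| <= (d - c) `^ (1 - i) * L `^ (i - p^-1).
Proof.
move=> c0 cd; rewrite -lee_fin; apply: le_trans (integral_itv_atom_le c0 cd).
rewrite fineK//; apply: integrable_fin_num => //; apply: atom_integrable_norm => //.
by move=> x; rewrite /Rpos/= !in_itv/= => /andP[cx _]; rewrite andbT (le_lt_trans c0).
Qed.

(** The exponents [1 - 1/q] from Hölder and [1/q - 1/p] from the normalisation add up to [1 - 1/p],
    so this bound no longer depends on [q]. *)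
Lemma Rintegral_norm_atom_le :
  \int[mu]_(x in @Rpos R) `|a x| <= L `^ (1 - p^-1).
Proof.
rewrite (@Rintegral_subset_eq0 _ `]x0, x1[).
- apply: le_trans (Rintegral_itv_atom_le (ltW x0_gt0) x01) _.
  by rewrite -powRD ?(gt_eqF L0) ?implybT// addrA subrK.
- by move=> x; rewrite /Rpos/= !in_itv/= => /andP[cx _]; rewrite andbT (lt_trans x0_gt0).
- move=> x; rewrite /Rpos/= !in_itv/= andbT => xgt0 /negP xx.
  by rewrite a_out// normr0.
Qed.

(** Left of [x0] the integrand vanishes on (0, x). Right of [x1] the integral over (0, x) is the
    full integral of [a], which is 0 by cancellation. *)
Lemma hardy_atom_out x : 0 < x -> ~~ (x0 < x < x1) -> hardy a x = 0.
Proof.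
move=> xgt0; rewrite negb_and -!leNgt /hardy => /orP[xx0|x1x].
  rewrite (@Rintegral_subset_eq0 _ set0)// ?Rintegral_set0 ?mulr0//.
  move=> y/=; rewrite in_itv/= => /andP[y0 yx] _; apply: a_out => //.
  by rewrite negb_and -leNgt (ltW (lt_le_trans yx xx0)).
rewrite -(@Rintegral_subset_eq0 (@Rpos R)) ?a0 ?mulr0//.
  by move=> y; rewrite /Rpos/= !in_itv/= => /andP[->].
move=> y; rewrite /Rpos/= !in_itv/= andbT => y0; rewrite y0/= => /negP.
rewrite -leNgt => xy; apply: a_out => //.
by rewrite negb_and -[~~ (y < x1)]leNgt (le_trans x1x xy) orbT.
Qed.

(** Hölder is applied on (x0, x), and the factor 1/x is enlarged to 1/(x - x0), so that the bound
    depends only on the distance to [x0]. *)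
Lemma hardy_atom_le x : x0 < x ->
  `|hardy a x| <= (x - x0) `^ (- i) * L `^ (i - p^-1).
Proof.
move=> x0x; have xgt0 : 0 < x := lt_trans x0_gt0 x0x.
have y0 : 0 < x - x0 by rewrite subr_gt0.
rewrite /hardy normrM gtr0_norm ?invr_gt0//.
have sub : `]0, x[ `<=` @Rpos R.
  by move=> y; rewrite /Rpos/= !in_itv/= => /andP[->].
have A : `|\int[mu]_(t in `]0, x[) a t| <= (x - x0) `^ (1 - i) * L `^ (i - p^-1).
  apply: le_trans (Rintegral_itv_atom_le (ltW x0_gt0) x0x).
  apply: le_trans (le_normr_Rintegral _ (atom_integrableS _ _)) _ => //.
  rewrite (@Rintegral_subset_eq0 `]0, x[ `]x0, x[)//.
    by move=> y/=; rewrite !in_itv/= => /andP[x0y ->]; rewrite (lt_trans x0_gt0 x0y).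
  move=> y/=; rewrite !in_itv/= => /andP[ygt0 yx]; rewrite yx andbT => x0y.
  by rewrite a_out ?normr0//; apply/negP => /andP[].
apply: (@le_trans _ _ ((x - x0)^-1 * ((x - x0) `^ (1 - i) * L `^ (i - p^-1)))).
  apply: ler_pM => //; first by rewrite invr_ge0 ltW.
  by rewrite lef_pV2 ?posrE// gerBl ltW.
rewrite mulrA ler_wpM2r ?powR_ge0//.
rewrite -{1}(powR_inv1 (ltW y0)) -powRD ?(gt_eqF y0) ?implybT//.
by rewrite addrA addNr add0r.
Qed.

(* Cancellation: the integrals of [a] over (0,x) and (x,oo) are opposite. *)
Lemma hardy_atom_le_half x : 0 < x ->
  `|hardy a x| <= 2^-1 * (x^-1 * L `^ (1 - p^-1)).
Proof.
move=> xgt0; rewrite /hardy normrM gtr0_norm ?invr_gt0// mulrCA.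
rewrite ler_wpM2l ?invr_ge0 ?(ltW xgt0)//.
have sub1 : `]0, x[ `<=` @Rpos R.
  by move=> y; rewrite /Rpos/= !in_itv/= => /andP[->].
have sub2 : `[x, +oo[ `<=` @Rpos R.
  by move=> y; rewrite /Rpos/= !in_itv/= !andbT => /(lt_le_trans xgt0).
have U : @Rpos R = `]0, x[ `|` `[x, +oo[.
  apply/seteqP; split => y; rewrite /Rpos/= !in_itv/= !andbT.
    by move=> ->; case: (ltP y x); [left|right].
  by case=> [/andP[]|/(lt_le_trans xgt0)].
have dis : [disjoint `]0, x[%classic & `[x, +oo[%classic].
  apply/disj_setPS => y /= [/=]; rewrite !in_itv/= andbT => /andP[_ yx].
  by rewrite leNgt yx.
have e1 : \int[mu]_(t in `]0, x[) a t + \int[mu]_(t in `[x, +oo[) a t = 0.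
  by rewrite -Rintegral_setU//= -?U ?a0//; exact: atom_integrable.
have e2 : \int[mu]_(t in `]0, x[) `|a t| + \int[mu]_(t in `[x, +oo[) `|a t|
    <= L `^ (1 - p^-1).
  rewrite -Rintegral_setU//= -?U; first exact: Rintegral_norm_atom_le.
  by apply: atom_integrable_norm => //; exact: measurable_Rpos.
have nle D : measurable D -> D `<=` @Rpos R ->
    `|\int[mu]_(t in D) a t| <= \int[mu]_(t in D) `|a t|.
  by move=> mD DR; apply: le_normr_Rintegral => //; exact: atom_integrableS.
have := nle _ (measurable_itv `]0, x[) sub1.
have := nle _ (measurable_itv `[x, +oo[) sub2.
have -> : \int[mu]_(t in `[x, +oo[) a t = - \int[mu]_(t in `]0, x[) a t.
  by apply/eqP; rewrite -addr_eq0 addrC e1.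
rewrite normrN => h1 h2.
lra.
Qed.

End atom.

(** * Integrals of powers with a singular endpoint *)

Section power_integral.
Context {R : realType}.
Notation mu := (@lebesgue_measure R).

Lemma integral_is_derive (f F : R -> R) (a b : R) : a < b ->
  (forall x, a <= x <= b -> is_derive x 1 F (f x)) ->
  (forall x, a <= x <= b -> {for x, continuous f}) ->
  (\int[mu]_(x in `[a, b]) (f x)%:E = (F b - F a)%:E)%E.
Proof.
move=> ab dF cf; rewrite EFinB; apply: continuous_FTC2 => //.
- apply: continuous_in_subspaceT => x /set_mem/=; rewrite in_itv/=; exact: cf.
- split.
  + move=> x; rewrite in_itv/= => /andP[ax xb].
    by have [] := dF x _; first by rewrite (ltW ax) (ltW xb).
  + apply: cvg_at_right_filter; apply: differentiable_continuous.
    by apply/derivable1_diffP; have [] := dF a _; first by rewrite lexx ltW.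
  + apply: cvg_at_left_filter; apply: differentiable_continuous.
    by apply/derivable1_diffP; have [] := dF b _; first by rewrite lexx ltW.
- move=> x; rewrite in_itv/= => /andP[ax xb].
  rewrite derive1E; have [|_ ->//] := dF x _.
  by rewrite (ltW ax) (ltW xb).
Qed.

Lemma measurable_fun_shift_powR (c r : R) :
  measurable_fun [set: R] (fun x : R => (x - c) `^ r).
Proof.
apply: (measurableT_comp (measurable_powR r)) => //.
exact: measurable_funB.
Qed.

Lemma near_natSinv_lt (e : R) : 0 < e -> \forall n \near \oo, n.+1%:R^-1 < e.
Proof. by move=> e0; exact: (near_infty_natSinv_lt (PosNum e0)). Qed.

Lemma is_derive_shift_powR (c r x : R) : c < x ->
  is_derive x 1 (fun x => (x - c) `^ r) (r * (x - c) `^ (r - 1)).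
Proof.
move=> cx; have xc : 0 < x - c by rewrite subr_gt0.
have d1 : is_derive x 1 (fun x : R => x - c) 1.
  by apply: is_derive_eq; rewrite subr0.
have := is_derive1_comp (is_derive1_powR r xc : is_derive ((fun x : R => x - c) x) 1 _ _) d1.
by rewrite mulr1.
Qed.

(** The integrand may blow up at [c], so the fundamental theorem is applied on [c + 1/(n+1), d] and
    monotone convergence gives the limit. The primitive at the left end is nonnegative and is
    dropped, whence an inequality. *)
Lemma integral_shift_powR_le (c d s : R) : c < d -> s < 1 ->
  (\int[mu]_(x in `]c, d]) ((x - c) `^ (- s))%:E <=
     ((d - c) `^ (1 - s) / (1 - s))%:E)%E.
Proof.
move=> cd s1; have s1' : 0 < 1 - s by rewrite subr_gt0.
pose g (n : nat) := (fun x : R => ((x - c) `^ (- s))%:E) \_ `[c + n.+1%:R^-1, d].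
have mg n : measurable_fun [set: R] (g n).
  apply/(measurable_restrictT _ _).1 => //; apply/measurable_EFinP.
  by apply: measurable_funTS; exact: measurable_fun_shift_powR.
have g0 n x : (0 <= g n x)%E.
  by rewrite /g patchE; case: ifP => // _; rewrite lee_fin powR_ge0.
have ndg x m n : (m <= n)%N -> (g m x <= g n x)%E.
  move=> mn; rewrite /g !patchE; case: ifPn => [/set_mem/=|_].
    rewrite in_itv/= => /andP[mx xd]; rewrite mem_set//= in_itv/= xd andbT.
    by apply: le_trans mx; rewrite lerD2l lef_pV2 ?posrE// ler_nat.
  by case: ifP => // _; rewrite lee_fin powR_ge0.
have lim_g x : c < x <= d -> limn (g ^~ x) = ((x - c) `^ (- s))%:E.
  move=> /andP[cx xd]; apply/cvg_lim => //.
  apply: cvg_near_cst; near=> n; rewrite /g patchE mem_set//= in_itv/= xd andbT.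
  rewrite -lerBrDl; near: n.
  have xc : 0 < x - c by rewrite subr_gt0.
  by apply: filterS (near_natSinv_lt xc) => n; exact: ltW.
have mD : measurable (`]c, d]%classic : set R) by exact: measurable_itv.
rewrite (_ : (\int[mu]_(x in _) _)%E = \int[mu]_(x in `]c, d]) limn (g ^~ x))%E; last first.
  apply: eq_integral => x /set_mem/=; rewrite in_itv/= => cxd.
  by rewrite lim_g.
rewrite (@monotone_convergence _ _ _ mu _ mD g).
- apply: lime_le.
    apply: ereal_nondecreasing_is_cvgn => m n mn.
    apply: ge0_le_integral => //.
    - exact: measurable_funTS (mg m).
    - exact: measurable_funTS (mg n).
    - by move=> x _; exact: ndg.
  near=> n.
  have cnd : c + n.+1%:R^-1 < d.
    rewrite -ltrBrDl; near: n.
    by apply: near_natSinv_lt; rewrite subr_gt0.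
  have cn : 0 < n.+1%:R^-1 :> R by rewrite invr_gt0 ltr0n.
  rewrite -integral_mkcondr (_ : _ `&` _ = `[c + n.+1%:R^-1, d]%classic); last first.
    apply/seteqP; split => x /=; rewrite !in_itv/=; first by move=> [].
    by move=> /andP[h ->]; rewrite andbT h; split => //; rewrite (lt_le_trans _ h)// ltrDl.
  pose F x := (1 - s)^-1 * (x - c) `^ (1 - s).
  have -> : (\int[mu]_(x in `[(c + n.+1%:R^-1)%R, d]) ((x - c) `^ (- s))%:E =
      (F d - F (c + n.+1%:R^-1))%:E)%E.
    apply: integral_is_derive => // x /andP[cx xd].
    + have xc : c < x by rewrite (lt_le_trans _ cx)// ltrDl.
      have := is_deriveZ (1 - s)^-1 (is_derive_shift_powR (1 - s) xc).
      rewrite /F; congr (is_derive _ _ _ _).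
      rewrite -[LHS]/((1 - s)^-1 * ((1 - s) * (x - c) `^ (1 - s - 1))).
      by rewrite mulKf ?gt_eqF//; congr (_ `^ _); ring.
    + have xc : c < x by rewrite (lt_le_trans _ cx)// ltrDl.
      apply: differentiable_continuous; apply/derivable1_diffP.
      by have [] := is_derive_shift_powR (- s) xc.
  rewrite lee_fin /F mulrC gerBl// mulr_ge0 ?powR_ge0// invr_ge0 ltW//.
- by move=> n; exact: measurable_funTS (mg n).
- by move=> n x _; exact: g0.
- by move=> x _ m n; exact: ndg.
Unshelve. all: by end_near. Qed.

End power_integral.

(** * The uniform bound for a single atom, and for series *)

Section gain.
Context {R : realType}.
Notation mu := (@lebesgue_measure R).

(** The constant K of the introduction, with [s = p/q]. The first term is the integral of L^(s-1)
    y^(-s) over 0 < y < 3L/4; the second is the bound (2/3)^p / L times the remaining length L/4. *)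
Definition hardy_atom_const (s p : R) : R :=
  (3 / 4) `^ (1 - s) / (1 - s) + (2 / 3) `^ p / 4.

(** For r < 1 this is Young's inequality for the product of x^r and 1, with conjugate exponents 1/r
    and 1/(1-r). *)
Lemma powR_bernoulli (x r : R) : 0 <= x -> 0 < r <= 1 -> x `^ r <= 1 + r * (x - 1).
Proof.
move=> x0 /andP[r0]; rewrite le_eqVlt => /predU1P[->|r1].
  by rewrite powRr1// mul1r subrKC.
have s0 : 0 < 1 - r by rewrite subr_gt0.
have := @conjugate_powR R (x `^ r) 1 r^-1 (1 - r)^-1 (powR_ge0 _ _) ler01.
rewrite !invr_gt0 !invrK => /(_ r0 s0 (subrKC _ _)).
rewrite mulr1 -powRrM mulfV ?gt_eqF// powRr1// powR1; lra.
Qed.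

(** Bernoulli gives (3/4)^(1-s) <= 1 - (1-s)/4, so the first term is at most 1/(1-s) - 1/4, while
    the second is strictly below 1/4. *)
Lemma hardy_atom_const_lt (s p : R) : 0 <= s < 1 -> 0 < p ->
  hardy_atom_const s p < (1 - s)^-1.
Proof.
move=> /andP[s0 s1] p0; rewrite /hardy_atom_const.
have r0 : 0 < 1 - s by rewrite subr_gt0.
have h1 : (3 / 4) `^ (1 - s) / (1 - s) <= (1 - s)^-1 - 1 / 4.
  rewrite ler_pdivrMr// mulrBl mulVf ?gt_eqF//.
  apply: le_trans (powR_bernoulli _ _) _; [lra|lra|].
  lra.
have h2 : (2 / 3 : R) `^ p < 1.
  apply: (@lt_le_trans _ _ (1 `^ p)); last by rewrite powR1.
  apply: gt0_ltr_powR => //; rewrite ?nnegrE; lra.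
lra.
Qed.

Lemma hardy_atom_const_gt0 (s p : R) : s < 1 -> 0 < hardy_atom_const s p.
Proof.
move=> s1; rewrite /hardy_atom_const addr_gt0// divr_gt0 ?powR_gt0// ?subr_gt0//; lra.
Qed.

(** After division by x + y, the inequality t <= t^r on [0, 1] is applied to two numbers whose sum
    is 1. *)
Lemma powR_subadditive (x y r : R) : 0 <= x -> 0 <= y -> 0 < r <= 1 ->
  (x + y) `^ r <= x `^ r + y `^ r.
Proof.
move=> x0 y0 /andP[r0 r1].
have [/eqP|xy] := eqVneq (x + y) 0.
  by rewrite paddr_eq0// => /andP[/eqP -> /eqP ->]; rewrite addr0 lerDl powR_ge0.
have xy0 : 0 < x + y by rewrite lt0r xy addr_ge0.
have aux t : 0 <= t <= 1 -> t <= t `^ r.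
  move=> /andP[]; rewrite le_eqVlt => /predU1P[<-|t0] t1; first exact: powR_ge0.
  by apply: ger1_powR => //; rewrite t0 t1.
have hx : x / (x + y) <= (x / (x + y)) `^ r.
  by apply: aux; rewrite divr_ge0 ?ler_pdivrMr// ?(ltW xy0)// mul1r lerDl.
have hy : y / (x + y) <= (y / (x + y)) `^ r.
  by apply: aux; rewrite divr_ge0 ?ler_pdivrMr// ?(ltW xy0)// mul1r lerDr.
have e z : 0 <= z -> z `^ r = (z / (x + y)) `^ r * (x + y) `^ r.
  by move=> z0; rewrite -powRM ?divr_ge0 ?(ltW xy0)// divfK.
rewrite (e x)// (e y)// -mulrDl ler_peMl ?powR_ge0//.
by apply: le_trans (lerD hx hy); rewrite -mulrDl divff.
Qed.

Lemma norm_sum_powR_le (u : nat -> R) (r : R) n : 0 < r <= 1 ->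
  `|\sum_(0 <= k < n) u k| `^ r <= \sum_(0 <= k < n) `|u k| `^ r.
Proof.
move=> r01; elim: n => [|n ih].
  by rewrite !big_nil normr0 powR0// gt_eqF//; case/andP: r01.
rewrite !big_nat_recr//=; apply: le_trans (lerD ih (lexx _)).
apply: le_trans (powR_subadditive _ _ r01) => //.
apply: ge0_ler_powR; rewrite ?nnegrE ?addr_ge0//; last exact: ler_normD.
by case/andP: r01 => /ltW.
Qed.

(** Subadditivity bounds every partial sum, so convergence along the indices [e n] is enough. This
    generality serves a series whose partial sums are controlled only at multiples of four. *)
Lemma lim_series_powR_le (u : nat -> R) (T : nat -> \bar R) (l r : R)
    (e : nat -> nat) : 0 < r <= 1 ->
  (fun n => series u (e n)) @ \oo --> l -> (forall k, (0 <= T k)%E) ->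
  (forall k, ((`|u k| `^ r)%:E <= T k)%E) ->
  ((`|l| `^ r)%:E <= \sum_(0 <= k <oo) T k)%E.
Proof.
move=> r01 ul T0 uT; have /andP[r0 r1] := r01.
set S := (\sum_(0 <= k <oo) T k)%E.
have [->|Sfin] := eqVneq S +oo%E; first exact: leey.
have S0 : (0 <= S)%E by exact: nneseries_ge0.
have {}Sfin : S \is a fin_num by rewrite ge0_fin_numE// ltey.
have fS0 : 0 <= fine S by exact: fine_ge0.
have Sn n : `|series u (e n)| <= fine S `^ r^-1.
  rewrite -[leLHS](powRr1 (normr_ge0 _)) -(mulfV (lt0r_neq0 r0)) powRrM.
  apply: ge0_ler_powR; rewrite ?nnegrE ?invr_ge0 ?(ltW r0) ?powR_ge0//.
  rewrite -lee_fin fineK//.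
  apply: (@le_trans _ _ (\sum_(0 <= k < e n) T k)%E); last first.
    by apply: nneseries_lim_ge => k _ _; exact: T0.
  apply: (@le_trans _ _ (\sum_(0 <= k < e n) `|u k| `^ r)%:E).
    by rewrite lee_fin; exact: norm_sum_powR_le.
  by rewrite -sumEFin; apply: lee_sum => k _; exact: uT.
have lS : `|l| <= fine S `^ r^-1.
  rewrite -(cvg_lim _ (cvg_norm ul))//.
  apply: limr_le; first by apply/cvg_ex; eexists; exact: (cvg_norm ul).
  by apply: nearW => n; exact: Sn.
rewrite -(fineK Sfin) lee_fin -[leRHS](powRr1 fS0) -(mulVf (lt0r_neq0 r0)) powRrM.
by apply: ge0_ler_powR; rewrite ?nnegrE ?powR_ge0// ltW.
Qed.

Lemma exponent_lt1 (p : R) q : 0 < p -> (1 <= q)%E -> (p%:E < q)%E ->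
  0 <= p * inv_exponent q < 1.
Proof.
move=> p0 q1 pq; have /andP[i0 _] := inv_exponent_ge0_le1 q1.
rewrite mulr_ge0 ?(ltW p0)//= /inv_exponent.
case: q q1 pq {i0} => [r| |]// q1 pq; last by rewrite invey/= mulr0.
have r0 : 0 < r by rewrite -lte_fin; exact: lt_le_trans q1.
by rewrite inver gt_eqF//= ltr_pdivrMr// mul1r -lte_fin.
Qed.

(** An explicit piecewise majorant stands in for |H a|^p: it is visibly measurable and its integral
    can be estimated term by term. *)
Lemma hardy_atom_majorant (p : R) q a : 0 < p <= 1 -> (1 <= q)%E -> (p%:E < q)%E ->
  is_atom p q a -> exists B : R -> \bar R,
  [/\ measurable_fun [set: R] B, forall x, (0 <= B x)%E,
    forall x, 0 < x -> ((`|hardy a x| `^ p)%:E <= B x)%E &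
    (\int[mu]_(x in @Rpos R) B x <= (hardy_atom_const (p * inv_exponent q) p)%:E)%E].
Proof.
move=> /andP[p0 p1] q1 pq /is_atomP[ma [x0 [x1 [/andP[x0_gt0 x01] a_out aN a0]]]].
set i := inv_exponent q; set s := p * i; pose L := x1 - x0.
have /andP[s0 s1] : 0 <= s < 1 := exponent_lt1 p0 q1 pq.
have L0 : 0 < L by rewrite subr_gt0.
(* Up to [m] the Hölder bound is used, beyond it the bound from cancellation. *)
pose m := x0 + 3 / 4 * L.
have x0m : x0 < m by rewrite ltrDl; lra.
have mx1 : m < x1 by rewrite /m /L; lra.
pose f1 (x : R) := L `^ (s - 1) * (x - x0) `^ (- s).
pose f2 (x : R) := (2 / 3) `^ p / L.
have f1_ge0 x : 0 <= f1 x by rewrite mulr_ge0 ?powR_ge0.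
have f2_ge0 x : 0 <= f2 x by rewrite divr_ge0 ?powR_ge0 ?ltW.
pose B1 := (EFin \o f1) \_ `]x0, m]; pose B2 := (EFin \o f2) \_ `]m, x1[.
have mf1 : measurable_fun [set: R] f1.
  by apply: measurable_funM => //; exact: measurable_fun_shift_powR.
have mB1 : measurable_fun [set: R] B1.
  apply/(measurable_restrictT _ _).1 => //; apply/measurable_EFinP.
  exact: measurable_funTS.
have mB2 : measurable_fun [set: R] B2.
  apply/(measurable_restrictT _ _).1 => //; apply/measurable_EFinP.
  exact: measurable_cst.
have B1_ge0 x : (0 <= B1 x)%E.
  by rewrite /B1 patchE; case: ifP => // _; rewrite lee_fin.
have B2_ge0 x : (0 <= B2 x)%E.
  by rewrite /B2 patchE; case: ifP => // _; rewrite lee_fin.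
exists (fun x => B1 x + B2 x)%E; split.
- exact: emeasurable_funD.
- by move=> x; rewrite adde_ge0.
- move=> x xgt0; have [x_in|x_out] := boolP (x0 < x < x1); last first.
    by rewrite (@hardy_atom_out _ a x0 x1)// normr0 powR0 ?gt_eqF// adde_ge0.
  have /andP[x0x xx1] := x_in; have y0 : 0 < x - x0 by rewrite subr_gt0.
  have [xm|mx] := leP x m.
    have xI : x \in `]x0, m]%classic by apply/mem_set; rewrite /= in_itv/= x0x.
    rewrite {1}/B1 patchE xI.
    apply: (@le_trans _ _ (f1 x)%:E); last by rewrite leeDl.
    rewrite lee_fin; apply: (@le_trans _ _ (((x - x0) `^ (- i) * L `^ (i - p^-1)) `^ p)).
      apply: ge0_ler_powR; rewrite ?nnegrE ?(ltW p0) ?mulr_ge0 ?powR_ge0//.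
      exact: hardy_atom_le.
    rewrite powRM ?powR_ge0// -!powRrM mulrC /f1 mulNr [i * p]mulrC.
    by rewrite mulrBl mulVf ?gt_eqF// [i * p]mulrC.
  have xI : x \in `]m, x1[%classic by apply/mem_set; rewrite /= in_itv/= mx.
  rewrite {1}/B2 patchE xI.
  have c0 : 0 <= 2 / 3 :> R by lra.
  apply: (@le_trans _ _ (f2 x)%:E); last by rewrite leeDr.
  (* Here x > m > 3L/4, so 1/(2x) is at most (2/3)/L. *)
  rewrite lee_fin; apply: (@le_trans _ _ ((2 / 3 * L `^ (- p^-1)) `^ p)).
    apply: ge0_ler_powR; rewrite ?nnegrE ?(ltW p0) ?mulr_ge0 ?powR_ge0//.
    apply: le_trans (hardy_atom_le_half q1 ma x0_gt0 x01 a_out aN a0 xgt0) _.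
    rewrite -/L powRD ?(gt_eqF L0) ?implybT// powRr1 ?(ltW L0)//.
    rewrite !mulrA ler_wpM2r ?powR_ge0// -mulrA.
    rewrite -ler_pdivlMl ?invr_gt0// invrK ler_pdivrMl//.
    by rewrite -/m in mx; rewrite /m in mx; lra.
  rewrite powRM ?powR_ge0//.
  by rewrite -powRrM mulNr mulVf ?gt_eqF// powR_inv1 ?(ltW L0).
- apply: (@le_trans _ _ (\int[mu]_x (B1 x + B2 x))%E).
    apply: ge0_subset_integral => //; [exact: measurable_Rpos|exact: emeasurable_funD|].
    by move=> x _; rewrite adde_ge0.
  rewrite ge0_integralD//.
  rewrite -integral_mkcond -integral_mkcond EFinD.
  apply: leeD.
    rewrite /f1 /=; under eq_integral do rewrite EFinM.
    rewrite ge0_integralZl//; last 3 first.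
    + by apply/measurable_EFinP; apply: measurable_funTS; exact: measurable_fun_shift_powR.
    + by move=> x _; rewrite lee_fin powR_ge0.
    + by rewrite lee_fin powR_ge0.
    apply: le_trans (lee_wpmul2l _ (integral_shift_powR_le x0m s1)) _.
      by rewrite lee_fin powR_ge0.
    have -> : m - x0 = 3 / 4 * L by rewrite /m addrAC subrr add0r.
    have c1 : 0 <= 3 / 4 :> R by lra.
    rewrite lee_fin powRM ?(ltW L0)//.
    rewrite mulrA mulrCA -powRD ?(gt_eqF L0) ?implybT//.
    by rewrite (_ : s - 1 + (1 - s) = 0) ?powRr0 ?mulr1//; ring.
  rewrite (_ : (\int[mu]_(x in _) _)%E = (((2 / 3) `^ p / L)%:E * mu `]m, x1[)%E); last first.
    by rewrite -integral_cst.
  rewrite lebesgue_measure_itv/= lte_fin mx1 -EFinB -EFinM lee_fin.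
  rewrite -mulrA ler_wpM2l ?powR_ge0// ler_pdivrMl// /m /L; lra.
Qed.

(** Subadditivity is used pointwise and the majorants are then integrated termwise. Only domination
    of [h] by a limit along [e] is asked, so the lemma serves both for the transform itself and for
    a lower bound of such a limit. *)
Lemma hardy_series_integral_le (p : R) q (lam : nat -> R) (a : nat -> R -> R)
    (h : R -> R) (e : nat -> nat) :
  0 < p <= 1 -> (1 <= q)%E -> (p%:E < q)%E -> (forall k, is_atom p q (a k)) ->
  measurable_fun (@Rpos R) h ->
  {ae mu, forall x, 0 < x ->
     exists2 l, (fun n => series (fun k => lam k * hardy (a k) x) (e n)) @ \oo --> l &
       `|h x| <= `|l|} ->
  (\int[mu]_(x in @Rpos R) (`|h x| `^ p)%:E <=
    (hardy_atom_const (p * inv_exponent q) p)%:E *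
    \sum_(0 <= k <oo) (`|lam k| `^ p)%:E)%E.
Proof.
move=> p01 q1 pq atoms mh hE; have /andP[p0 p1] := p01.
have /choice[B HB] : forall k, exists B : R -> \bar R,
  [/\ measurable_fun [set: R] B, forall x, (0 <= B x)%E,
    forall x, 0 < x -> ((`|hardy (a k) x| `^ p)%:E <= B x)%E &
    (\int[mu]_(x in @Rpos R) B x <= (hardy_atom_const (p * inv_exponent q) p)%:E)%E].
  by move=> k; exact: hardy_atom_majorant.
have mR := @measurable_Rpos R.
pose T k x := ((`|lam k| `^ p)%:E * B k x)%E.
have T0 k x : (0 <= T k x)%E.
  by rewrite mule_ge0// ?lee_fin ?powR_ge0//; have [] := HB k.
have mT k : measurable_fun (@Rpos R) (T k).
  apply: measurable_funTS; apply: emeasurable_funM => //.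
  by have [] := HB k.
apply: (@le_trans _ _ (\int[mu]_(x in @Rpos R) \sum_(0 <= k <oo) T k x)%E).
  apply: ae_ge0_le_integral => //.
  - apply/measurable_EFinP; apply: (measurableT_comp (measurable_powR p)) => //.
    exact: measurableT_comp.
  - by move=> x _; exact: nneseries_ge0.
  - apply: ge0_emeasurable_sum => k; last by move=> _; exact: mT.
    by move=> x _ _; exact: T0.
  - apply: (@filterS _ _ (ae_filter_ringOfSetsType mu) _ _ _ hE) => x hx xR.
    have xgt0 : 0 < x by move: xR; rewrite /Rpos/= in_itv/= andbT.
    have [l {}hx hl] := hx xgt0.
    apply: (@le_trans _ _ (`|l| `^ p)%:E).
      by rewrite lee_fin ge0_ler_powR ?nnegrE// ltW.
    apply: (lim_series_powR_le p01 hx); first by move=> k; exact: T0.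
    move=> k; rewrite normrM powRM// EFinM; apply: lee_wpmul2l.
      by rewrite lee_fin powR_ge0.
    by have [_ _ + _] := HB k; apply.
(* Sum and integral are exchanged, all terms being nonnegative. *)
rewrite integral_nneseries// -nneseriesZl; last by move=> k _; rewrite lee_fin powR_ge0.
apply: lee_nneseries => [k _ _|k _].
  by apply: integral_ge0 => x _; exact: T0.
have [mB B0 _ intB] := HB k.
rewrite ge0_integralZl//.
  by rewrite muleC; apply: lee_wpmul2r => //; rewrite lee_fin powR_ge0.
exact: (measurable_funTS mB).
Qed.

End gain.

(** * Positivity of the quasinorm for p >= 1/2 *)

Section test_functions.
Context {R : realType}.
Notation mu := (@lebesgue_measure R).
Implicit Types phi : R -> R.

Lemma is_derive_derive1n phi n (x : R) : test_function phi ->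
  is_derive x 1 (derive1n n phi) (derive1n n.+1 phi x).
Proof.
move=> [dphi _ _]; rewrite /= derive1E.
exact: (derivableP (dphi n x)).
Qed.

Lemma continuous_derive1n phi n : test_function phi -> continuous (derive1n n phi).
Proof.
move=> [dphi _ _] x; apply: differentiable_continuous; apply/derivable1_diffP.
exact: dphi.
Qed.

(** The complement of the closed support is open, so vanishing there at order n is local and passes
    to the next derivative. *)
Lemma derive1n_eq0 phi n x : ~ closure [set x | phi x != 0] x ->
  derive1n n phi x = 0.
Proof.
elim: n x => [|n ih] x.
  by apply: contra_notP => /eqP phix; apply: subset_closure.
move=> xS; rewrite /= derive1E.
have : \near x, derive1n n phi x = cst 0 x.
  have : open (~` closure [set x | phi x != 0]).
    by apply: closed_openC; exact: closed_closure.
  move=> oS; have : open_nbhs x (~` closure [set x | phi x != 0]) by [].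
  by move=> /open_nbhs_nbhs; apply: filterS => y /ih.
by move=> /near_eq_derive ->; rewrite derive_cst.
Qed.

Lemma derive1n_bounded phi n : test_function phi ->
  exists2 M : R, 0 < M & forall x, `|derive1n n phi x| <= M.
Proof.
move=> tphi; have [_ cS _] := tphi.
have [B [Breal SB]] := compact_bounded cS.
pose r := `|B| + 1.
have rB : B < r by rewrite (le_lt_trans (ler_norm B))// ltrDl.
have r0 : 0 <= r by rewrite addr_ge0.
have rr : - r <= r by lra.
have [|c _ cmax] := EVT_max (f := fun x => `|derive1n n phi x|) rr.
  apply: continuous_subspaceT => x.
  by apply: continuous_comp; [exact: continuous_derive1n|exact: norm_continuous].
exists (`|derive1n n phi c| + 1); first by rewrite ltr_wpDl.
move=> x; have [xr|xr] := leP `|x| r.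
  by rewrite (le_trans (cmax x _)) ?lerDl// in_itv/= -ler_norml.
rewrite derive1n_eq0 ?normr0 ?addr_ge0// => xS.
by have := SB r rB x xS; rewrite /= leNgt xr.
Qed.

Lemma derive1n_lipschitz phi n : test_function phi ->
  exists2 M : R, 0 < M & forall x y,
    `|derive1n n phi x - derive1n n phi y| <= M * `|x - y|.
Proof.
move=> tphi; have [M M0 HM] := derive1n_bounded n.+1 tphi.
exists M => // x y.
wlog xy : x y / x < y => [hw|].
  have [xy|yx|->] := ltgtP x y; first exact: hw.
    by rewrite distrC [X in _ * X]distrC; exact: hw.
  by rewrite !subrr normr0 mulr0.
have [c _ e] : exists2 c, c \in `]x, y[%R &
    derive1n n phi y - derive1n n phi x = derive1n n.+1 phi c * (y - x).
  apply: (@MVT R (derive1n n phi) (derive1n n.+1 phi) x y xy) => [z _|].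
    exact: is_derive_derive1n.
  by apply: continuous_subspaceT => z; exact: continuous_derive1n.
by rewrite distrC [X in _ * X]distrC e normrM ler_wpM2r.
Qed.

Lemma measurable_derive1n phi n (D : set R) : test_function phi ->
  measurable_fun D (derive1n n phi).
Proof.
move=> tphi; apply: measurable_funTS; apply: continuous_measurable_fun.
exact: continuous_derive1n.
Qed.

Lemma integrable_scale (D : set R) (c : R) (g : R -> R) : measurable D ->
  mu.-integrable D (EFin \o g) -> mu.-integrable D (EFin \o (fun x => c * g x)).
Proof.
move=> mD ig; rewrite (_ : _ \o _ = (fun x => c%:E * (EFin \o g) x)%E)//.
exact: integrableZl.
Qed.

(** For L > 1 the supremum of [phi] suffices, since L^(1-1/p) <= 1. For L <= 1 cancellation replaces
    [phi] by [phi - phi x0], and the Lipschitz bound gains a factor L: the result L^(2-1/p) is at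
    most 1 exactly because p >= 1/2. *)
Lemma pairing_atom_bounded (p : R) q phi : 2^-1 <= p <= 1 -> (1 <= q)%E ->
  test_function phi ->
  exists2 M : R, 0 < M & forall a, is_atom p q a -> `|pairing a phi| <= M.
Proof.
move=> /andP[p2 p1] q1 tphi; have p0 : 0 < p by apply: lt_le_trans p2; lra.
have [M0 M0_gt0 HM0] := derive1n_bounded 0 tphi.
have [M1 M1_gt0 HM1] := derive1n_lipschitz 0 tphi.
rewrite /= in HM0 HM1.
exists (M0 + M1); first exact: addr_gt0.
move=> a /is_atomP[ma [x0 [x1 [/andP[x0_gt0 x01] a_out aN a0]]]].
pose L := x1 - x0; have L0 : 0 < L by rewrite subr_gt0.
have mR := @measurable_Rpos R.
have inta : mu.-integrable (@Rpos R) (EFin \o a).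
  exact: (atom_integrable q1 ma x0_gt0 x01 a_out aN).
have intna : mu.-integrable (@Rpos R) (EFin \o (fun x => `|a x|)).
  exact: integrable_norm.
have mphi : measurable_fun (@Rpos R) phi by exact: (measurable_derive1n 0).
have int_mul (c C : R) : 0 <= C ->
    (forall x, Rpos x -> `|a x * (phi x - c)| <= C * `|a x|) ->
    mu.-integrable (@Rpos R) (EFin \o (fun x => a x * (phi x - c))) /\
    `|\int[mu]_(x in @Rpos R) (a x * (phi x - c))| <= C * L `^ (1 - p^-1).
  move=> C0 gC.
  have intC : mu.-integrable (@Rpos R) (EFin \o (fun x => C * `|a x|)).
    exact: integrable_scale.
  have intg : mu.-integrable (@Rpos R) (EFin \o (fun x => a x * (phi x - c))).
    apply: le_integrable intC => //.
      apply/measurable_EFinP; apply: measurable_funM => //.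
      exact: measurable_funB.
    move=> x xR; rewrite lee_fin [leRHS]ger0_norm; first exact: gC.
    by rewrite mulr_ge0.
  split => //.
  apply: le_trans (le_normr_Rintegral _ intg) _ => //.
  apply: (@le_trans _ _ (\int[mu]_(x in @Rpos R) (C * `|a x|))).
    by apply: le_Rintegral => //; exact: integrable_norm intg.
  rewrite RintegralZl// ler_wpM2l//.
  exact: (Rintegral_norm_atom_le q1 ma x0_gt0 x01 a_out aN).
have [int0 le0] : mu.-integrable (@Rpos R) (EFin \o (fun x => a x * (phi x - 0))) /\
    `|\int[mu]_(x in @Rpos R) (a x * (phi x - 0))| <= M0 * L `^ (1 - p^-1).
  apply: int_mul => [|x _]; first exact: ltW.
  by rewrite subr0 normrM mulrC ler_wpM2r.
(* By cancellation any constant may be subtracted from the test function. *)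
have pE c : pairing a phi = \int[mu]_(x in @Rpos R) (a x * (phi x - c)).
  rewrite -[LHS]subr0 -(mulr0 c) -a0 -RintegralZl// /pairing.
  rewrite -RintegralB//; last exact: integrable_scale; last first.
    by apply: eq_integrable int0 => // x _ /=; rewrite subr0.
  by apply: eq_Rintegral => x _; ring.
have [L1|L1] := leP L 1; last first.
  rewrite (pE 0); apply: le_trans le0 _.
  apply: (@le_trans _ _ M0); last by rewrite lerDl ltW.
  rewrite ler_piMr ?(ltW M0_gt0)//.
  apply: (@le_trans _ _ (L `^ 0)); last by rewrite powRr0.
  apply: ler_powR; first exact: ltW.
  by rewrite subr_le0 -[leLHS]invr1 lef_pV2 ?posrE.
have [_ le1] : mu.-integrable (@Rpos R) (EFin \o (fun x => a x * (phi x - phi x0))) /\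
    `|\int[mu]_(x in @Rpos R) (a x * (phi x - phi x0))| <= (M1 * L) * L `^ (1 - p^-1).
  apply: int_mul => [|x]; first by rewrite mulr_ge0 ?ltW.
  rewrite /Rpos/= in_itv/= andbT => xgt0.
  have [/andP[x0x xx1]|xx] := boolP (x0 < x < x1); last first.
    by rewrite a_out// mul0r normr0 mulr0.
  rewrite normrM mulrC ler_wpM2r//; apply: le_trans (HM1 _ _) _.
  by rewrite ler_wpM2l ?(ltW M1_gt0)// gtr0_norm ?subr_gt0// lerD2r ltW.
rewrite (pE (phi x0)); apply: le_trans le1 _.
apply: (@le_trans _ _ M1); last by rewrite lerDr ltW.
rewrite -mulrA ler_piMr ?(ltW M1_gt0)// -{1}(powRr1 (ltW L0)).
rewrite -powRD ?(gt_eqF L0) ?implybT//.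
apply: (@le_trans _ _ (L `^ 0)); last by rewrite powRr0.
apply: ger_powR; first by rewrite L0 L1.
have : p^-1 <= 2 by rewrite -[leRHS]invrK lef_pV2 ?posrE.
lra.
Qed.

(** Subadditivity applied to the series for [f phi]. The constant depends on neither [f] nor the
    decomposition, so a nonzero value [f phi] bounds the quasinorm away from 0. *)
Lemma pairing_le_cost (p : R) q phi : 2^-1 <= p <= 1 -> (1 <= q)%E ->
  test_function phi ->
  exists2 M : R, 0 < M & forall f lam a, atomic_decomposition p q f lam a ->
    ((`|f phi| `^ p)%:E <= M%:E * \sum_(0 <= k <oo) (`|lam k| `^ p)%:E)%E.
Proof.
move=> p2 q1 tphi; have [M M0 HM] := pairing_atom_bounded p2 q1 tphi.
have p01 : 0 < p <= 1.
  by case/andP: p2 => p2 ->; rewrite andbT (lt_le_trans _ p2)// invr_gt0.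
have /andP[p0 _] := p01.
exists (M `^ p) => [|f lam a [atoms _ fE]]; first exact: powR_gt0.
rewrite -nneseriesZl; last by move=> k _; rewrite lee_fin powR_ge0.
apply: (lim_series_powR_le (e := id) p01 (fE _ tphi)) => k.
  by rewrite mule_ge0// lee_fin powR_ge0.
rewrite -EFinM lee_fin normrM powRM// mulrC ler_wpM2r ?powR_ge0//.
by apply: ge0_ler_powR; rewrite ?nnegrE ?(ltW p0) ?(ltW M0)//; exact: HM.
Qed.

End test_functions.

(** * Nonuniqueness of the Hardy transform for p < 1/2 *)

Section interleave.
Context {R : realType}.

Definition interleave {T : Type} (u v : nat -> T) (n : nat) : T :=
  if odd n then v n./2 else u n./2.

Lemma comp_interleave {T U : Type} (g : T -> U) (u v : nat -> T) :
  g \o interleave u v = interleave (g \o u) (g \o v).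
Proof. by apply/funext => n; rewrite /interleave /=; case: ifP. Qed.

Lemma interleave_double {T : Type} (u v : nat -> T) n :
  interleave u v n.*2 = u n.
Proof. by rewrite /interleave odd_double doubleK. Qed.

Lemma interleave_doubleS {T : Type} (u v : nat -> T) n :
  interleave u v n.*2.+1 = v n.
Proof. by rewrite /interleave /= odd_double uphalf_double. Qed.

Lemma sum_interleave_double {V : nmodType} (u v : nat -> V) n :
  \sum_(0 <= k < n.*2) interleave u v k = \sum_(0 <= k < n) (u k + v k).
Proof.
elim: n => [|n ih]; first by rewrite !big_nil.
rewrite doubleS 3?big_nat_recr//= ih interleave_double interleave_doubleS.
by rewrite addrA.
Qed.

(** Partial sums of even length are those of u + v; those of odd length have one extra term of [u],
    which tends to 0. *)
Lemma cvg_interleave_sum (u v : nat -> R) (l : R) : u @ \oo --> 0 ->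
  series (fun n => u n + v n) @ \oo --> l -> series (interleave u v) @ \oo --> l.
Proof.
move=> u0 uvl; apply/cvgrPdist_lt => e e0.
have e2 : 0 < e / 2 by rewrite divr_gt0.
move/cvgrPdist_lt: u0 => /(_ _ e2) [N1 _ H1].
move/cvgrPdist_lt: uvl => /(_ _ e2) [N2 _ H2].
exists (maxn N1 N2).*2 => // n /= nN.
have := odd_double_half n; set m := n./2 => nE.
have mN : (maxn N1 N2 <= m)%N by rewrite -(doubleK (maxn N1 N2)); exact: half_leq.
have [mN1 mN2] : (N1 <= m)%N /\ (N2 <= m)%N.
  by rewrite geq_max in mN; move/andP: mN.
have h2 := H2 m mN2; have h1 := H1 m mN1.
rewrite -nE; case: (odd n) => /=.
  rewrite add1n /series/= big_nat_recr//= sum_interleave_double interleave_double.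
  rewrite opprD addrA; apply: le_lt_trans (ler_normB _ _) _.
  by rewrite [e]splitr; apply: ltrD; last by rewrite sub0r normrN in h1.
rewrite add0n /series/= sum_interleave_double; apply: lt_trans h2 _.
by rewrite ltr_pdivrMr// ltr_pMr// ltrDr.
Qed.

Lemma nneseries_interleave_le (u v : nat -> \bar R) :
  (forall n, (0 <= u n)%E) -> (forall n, (0 <= v n)%E) ->
  (\sum_(0 <= k <oo) interleave u v k <=
   \sum_(0 <= k <oo) u k + \sum_(0 <= k <oo) v k)%E.
Proof.
move=> u0 v0.
have uv0 n : (0 <= interleave u v n)%E by rewrite /interleave; case: ifP.
apply: lime_le; first exact: is_cvg_nneseries.
apply: nearW => n.
apply: (@le_trans _ _ (\sum_(0 <= k < n.*2) interleave u v k)%E).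
  apply: lee_sum_nneg_natr => //.
  by rewrite -addnn leq_addr.
rewrite sum_interleave_double big_split/=.
by apply: leeD; apply: nneseries_lim_ge.
Qed.

End interleave.

(** * Atoms from bounded functions *)

Section explicit_atoms.
Context {R : realType}.
Notation mu := (@lebesgue_measure R).

(** A function bounded by 1 and living on an interval of length L has q-norm at most L^(1/q), so the
    factor L^(-1/p) normalises it. The gaps between [c, d] and (x0, x1) keep the closed support
    inside the open interval. *)
Lemma bounded_is_atom (p : R) q (g : R -> R) (x0 c d x1 : R) :
  0 < p -> (1 <= q)%E -> measurable_fun [set: R] g ->
  0 < x0 < c -> d < x1 -> x0 < x1 ->
  (forall x, `|g x| <= 1) -> (forall x, ~~ (c <= x <= d) -> g x = 0) ->
  \int[mu]_(x in @Rpos R) g x = 0 ->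
  is_atom p q (fun x => (x1 - x0) `^ (- p^-1) * g x).
Proof.
move=> p0 q1 mg /andP[x0_gt0 x0c] dx1 x01 g1 g_out g0.
set L := x1 - x0; have L0 : 0 < L by rewrite subr_gt0.
set a := (fun x => _).
have ma : measurable_fun [set: R] a by exact: measurable_funM.
have aR : measurable_fun (@Rpos R) a by exact: measurable_funTS.
have a_le x : `|a x| <= L `^ (- p^-1).
  by rewrite normrM ger0_norm ?powR_ge0// ler_piMr// powR_ge0.
have a_out x : ~ (`]x0, x1[%classic x) -> a x = 0.
  move=> xI; rewrite /a g_out ?mulr0//; apply/negP => /andP[cx xd]; apply: xI.
  by rewrite /= in_itv/= (lt_le_trans x0c cx) (le_lt_trans xd dx1).
split => //; exists x0, x1; split; rewrite ?x0_gt0 ?x01//.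
- have : support_pos a `<=` `[c, d]%classic.
    rewrite /support_pos closureE => x; apply; split; first exact: itv_closed.
    move=> y [_ ay]; rewrite /= in_itv/=; apply: contraT => ycd.
    by move: ay; rewrite /a g_out// mulr0 eqxx.
  move=> /subset_trans; apply => x /=; rewrite !in_itv/= => /andP[cx xd].
  by rewrite (lt_le_trans x0c cx) (le_lt_trans xd dx1).
- rewrite LnormRpos_restrict -/L unlock.
  have f_le x : `|(a \_ (@Rpos R)) x| <= L `^ (- p^-1).
    by rewrite patchE; case: ifP => // _; rewrite normr0 powR_ge0.
  case: q q1 => [r| |]// q1; last first.
    rewrite ifT; last exact: lebesgue_measure_setT_gt0.
    rewrite /inv_exponent invey/= sub0r; apply/ess_supP.
    by apply: nearW => x /=; rewrite lee_fin.
  have r0 : 0 < r by rewrite -lte_fin; exact: lt_le_trans q1.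
  apply: (@le_trans _ _ (((L `^ (- p^-1)) `^ r * L)%:E `^ r^-1)%E); last first.
    rewrite poweR_EFin lee_fin powRM ?powR_ge0 ?(ltW L0)// -!powRrM mulfV ?gt_eqF//.
    rewrite mulr1 -powRD ?(gt_eqF L0) ?implybT// /inv_exponent inver gt_eqF//=.
    by rewrite addrC.
  apply: gt0_ler_poweR; rewrite ?invr_ge0 ?(ltW r0)//.
  + by rewrite in_itv/= leey andbT integral_ge0.
  + by rewrite in_itv/= leey andbT lee_fin mulr_ge0 ?powR_ge0// ltW.
  apply: (@le_trans _ _ (\int[mu]_(x in `]x0, x1[) ((L `^ (- p^-1)) `^ r)%:E)%E); last first.
    by rewrite integral_cst//= lebesgue_measure_itv/= lte_fin x01 -EFinB -EFinM.
  rewrite [leRHS]integral_mkcond; apply: ge0_le_integral => //.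
  + by move=> x _; exact: poweR_ge0.
  + apply/measurable_EFinP.
    apply: (@measurableT_comp _ _ _ _ _ _ (fun y => y `^ r)); first exact: measurable_powR.
    apply: measurableT_comp => //.
    by apply/(measurable_restrictT _ _).1 => //; exact: measurable_Rpos.
  + by apply/(measurable_restrictT _ _).1.
  + move=> x _; rewrite [leRHS]patchE; case: ifPn => [_|/negP xI].
      by rewrite lee_fin ge0_ler_powR ?nnegrE ?powR_ge0// ltW.
    rewrite /= patchE; case: ifP => _; rewrite ?a_out ?normr0 ?powR0 ?gt_eqF//.
    by move=> h; apply: xI; apply/mem_set.
- rewrite RintegralZl// ?g0 ?mulr0//; first exact: measurable_Rpos.
  apply/integrableP; split; first by apply/measurable_EFinP; exact: measurable_funTS.
  apply: (@le_lt_trans _ _ (\int[mu]_x (cst 1%E \_ `[c, d]) x)%E).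
    rewrite integral_mkcond; apply: ge0_le_integral => //.
    + by move=> x _; rewrite patchE; case: ifP.
    + apply/(measurable_restrictT _ _).1; first exact: measurable_Rpos.
      apply: measurableT_comp => //; apply/measurable_EFinP; exact: measurable_funTS.
    + by apply/(measurable_restrictT _ _).1.
    + move=> x _; rewrite !patchE; case: ifPn => _; last by case: ifP.
      case: ifPn => [_|/negP xI]; first by rewrite lee_fin.
      rewrite /= g_out ?normr0//; apply/negP => cd; apply: xI.
      by apply/mem_set; rewrite /= in_itv.
  rewrite -integral_mkcond integral_cst//= mul1e lebesgue_measure_itv/=.
  by case: ifP => _; rewrite ?ltry// -EFinB ltry.
Qed.

End explicit_atoms.

(** * Spikes and the root atom *)

Section spikes.
Context {R : realType}.
Notation mu := (@lebesgue_measure R).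

Lemma continuous_antiderivative (g : R -> R) : continuous g ->
  exists G : R -> R, forall x : R, 0 < x -> is_derive x 1 G (g x).
Proof.
move=> cg; exists (fun x => \int[mu]_(t in `[0, x]) g t) => x x0.
have xx : x < x + 1 by rewrite ltrDl.
have ig : mu.-integrable `[0, x + 1] (EFin \o g).
  apply: continuous_compact_integrable; first exact: segment_compact.
  exact: continuous_subspaceT.
have [dG G'] := continuous_FTC1_closed xx ig x0 (cg x).
by apply: DeriveDef; [exact: dG|rewrite -derive1E; exact: G'].
Qed.

Lemma Rintegral_itvoo_is_derive (f F : R -> R) (a b : R) : a < b ->
  (forall x : R, a <= x <= b -> is_derive x 1 F (f x)) -> continuous f ->
  \int[mu]_(x in `]a, b[) f x = F b - F a.
Proof.
move=> ab dF cf.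
have mf : measurable_fun [set: R] f by exact: continuous_measurable_fun.
rewrite /Rintegral integral_itv_bndo_bndc; last first.
  by apply/measurable_EFinP; exact: measurable_funTS.
rewrite integral_itv_obnd_cbnd; last first.
  by apply/measurable_EFinP; exact: measurable_funTS.
by rewrite (@integral_is_derive _ f F)// => x _; exact: cf.
Qed.

(** The mean value theorem is used twice, first for t -> F(t + w) - F(t), then for [phi]. The left
    side will be the pairing of a spike with [phi]. *)
Lemma second_difference (phi F : R -> R) (x w : R) : test_function phi ->
  0 < x -> 0 < w -> (forall t : R, 0 < t -> is_derive t 1 F (phi t)) ->
  exists2 eta, x < eta < x + 2 * w &
    (F (x + w) - F x) - (F (x + 2 * w) - F (x + w)) =
    - (w ^+ 2 * derive1n 1 phi eta).
Proof.
move=> tphi x0 w0 dF.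
pose psi t := F (t + w) - F t.
have dshift (t : R) : is_derive t 1 (fun t : R => t + w) 1.
  by apply: is_derive_eq; rewrite addr0.
have dFw (t : R) : 0 < t -> is_derive t 1 (fun t => F (t + w)) (phi (t + w)).
  move=> t0; have t0' : 0 < t + w by rewrite addr_gt0.
  have := is_derive1_comp (dF _ t0' : is_derive ((fun t : R => t + w) t) 1 _ _) (dshift t).
  by rewrite mulr1.
have dpsi (t : R) : 0 < t -> is_derive t 1 psi (phi (t + w) - phi t).
  by move=> t0; apply: is_deriveB; [exact: dFw|exact: dF].
have xw : x < x + w by rewrite ltrDl.
have [c] : exists2 c, c \in `]x, x + w[%R &
    psi (x + w) - psi x = (phi (c + w) - phi c) * (x + w - x).
  apply: MVT => // [z|].
    by rewrite in_itv/= => /andP[xz _]; apply: dpsi; exact: lt_trans xz.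
  apply: continuous_in_subspaceT => z /set_mem/=; rewrite in_itv/= => /andP[xz _].
  apply: differentiable_continuous; apply/derivable1_diffP.
  by have [] := dpsi z (lt_le_trans x0 xz).
rewrite in_itv/= => /andP[xc cxw] e1.
have cw : c < c + w by rewrite ltrDl.
have [eta] : exists2 eta, eta \in `]c, c + w[%R &
    phi (c + w) - phi c = derive1n 1 phi eta * (c + w - c).
  apply: MVT => // [z _|]; first exact: (is_derive_derive1n 0).
  by apply: continuous_subspaceT => z; exact: (@continuous_derive1n _ phi 0 tphi z).
rewrite in_itv/= => /andP[ceta etacw] e2.
exists eta; first by apply/andP; split; lra.
have -> : x + 2 * w = x + w + w by ring.
rewrite -[LHS]opprB -/(psi (x + w)) -/(psi x) e1 e2; ring.
Qed.

(** A Haar function. Its primitive is a tent of height w and area w^2; mass refers to the area under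
    the primitive, so that a narrow spike of mass m acts nearly as m times the derivative of a Dirac
    mass. *)
Definition spike (x w t : R) : R :=
  \1_(`]x, x + w[%classic : set R) t - \1_(`]x + w, x + 2 * w[%classic : set R) t.

Lemma measurable_spike x w : measurable_fun [set: R] (spike x w).
Proof. by apply: measurable_funB => //; exact: measurable_indic. Qed.

Lemma spike_out x w t : 0 < w -> ~~ (x <= t <= x + 2 * w) -> spike x w t = 0.
Proof.
move=> w0 xtw; rewrite /spike !indicE.
rewrite !memNset ?subrr//= in_itv/= => /andP[h1 h2]; move/negP: xtw; apply; apply/andP; split; lra.
Qed.

Lemma spike_norm x w t : `|spike x w t| <= 1.
Proof.
rewrite /spike !indicE; case: (boolP (t \in _)) => [|_].
  move=> /set_mem/=; rewrite in_itv/= => /andP[_ txw].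
  rewrite memNset/= ?subr0 ?normr1//= in_itv/= => /andP[]; lra.
by case: (_ \in _); rewrite /= sub0r normrN ?normr1 ?normr0.
Qed.

Lemma integrable_indicM (a b : R) (g : R -> R) : 0 < a -> continuous g ->
  mu.-integrable (@Rpos R) (EFin \o (fun t => \1_(`]a, b[%classic : set R) t * g t)) /\
  \int[mu]_(t in @Rpos R) (\1_(`]a, b[%classic : set R) t * g t) =
    \int[mu]_(t in `]a, b[) g t.
Proof.
move=> a0 cg.
have ig : mu.-integrable `[a, b] (EFin \o g).
  apply: continuous_compact_integrable; first exact: segment_compact.
  exact: continuous_subspaceT.
have U : @Rpos R `&` `]a, b[ = `]a, b[%classic.
  apply/setIidr => t; rewrite /Rpos/= !in_itv/= andbT => /andP[at_ _].
  exact: lt_trans at_.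
have -> : (fun t => \1_(`]a, b[%classic : set R) t * g t) = g \_ `]a, b[.
  by apply/funext => t; rewrite patchE indicE; case: ifP => _; rewrite ?mul1r ?mul0r.
rewrite -Rintegral_mkcondr U; split => //.
rewrite -restrict_EFin; apply/integrable_restrict => //=.
  exact: measurable_Rpos.
rewrite U; apply: integrableS ig => //; exact: subset_itv_oo_cc.
Qed.

Lemma spike_Rintegral (x w : R) (g : R -> R) : 0 < x -> 0 < w -> continuous g ->
  mu.-integrable (@Rpos R) (EFin \o (fun t => spike x w t * g t)) /\
  \int[mu]_(t in @Rpos R) (spike x w t * g t) =
  \int[mu]_(t in `]x, x + w[) g t - \int[mu]_(t in `]x + w, x + 2 * w[) g t.
Proof.
move=> x0 w0 cg.
have [i1 <-] := integrable_indicM (x + w) x0 cg.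
have [i2 <-] := integrable_indicM (x + 2 * w) (addr_gt0 x0 w0) cg.
have mR := @measurable_Rpos R.
rewrite -RintegralB//.
have -> : (fun t => spike x w t * g t) = (fun t =>
    \1_(`]x, x + w[%classic : set R) t * g t -
    \1_(`]x + w, x + 2 * w[%classic : set R) t * g t).
  by apply/funext => t; rewrite /spike mulrBl.
split => //.
have -> : (EFin \o (fun t => \1_(`]x, x + w[%classic : set R) t * g t -
    \1_(`]x + w, x + 2 * w[%classic : set R) t * g t)) =
  ((EFin \o (fun t => (\1_(`]x, (x + w)%R[%classic : set R) t * g t)%R)) \-
   (EFin \o (fun t => (\1_(`](x + w)%R, (x + 2 * w)%R[%classic : set R) t * g t)%R)))%E by [].
exact: integrableB.
Qed.

Lemma pairing_scale c (g phi : R -> R) :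
  mu.-integrable (@Rpos R) (EFin \o (fun t => g t * phi t)) ->
  pairing (fun t => c * g t) phi = c * \int[mu]_(t in @Rpos R) (g t * phi t).
Proof.
move=> ig; rewrite -RintegralZl//; last exact: measurable_Rpos.
by apply: eq_Rintegral => t _; rewrite mulrA.
Qed.

(** The pair is a coefficient and an atom, whose product is m w^(-2) times the spike. The cost is
    the p-th power of m w^(-2) (3w)^(1/p), where 3w is the length of the atom's interval. *)
Lemma spike_atom (p : R) q (x w m : R) : 0 < p -> (1 <= q)%E ->
  0 < w <= x -> 0 <= m -> exists d : R * (R -> R),
  [/\ is_atom p q d.2, `|d.1| `^ p = 3 * m `^ p * w `^ (1 - 2 * p) &
    forall phi, test_function phi -> exists2 eta, x < eta < x + 2 * w &
      d.1 * pairing d.2 phi = - (m * derive1n 1 phi eta)].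
Proof.
move=> p0 q1 /andP[w0 wx] m0; have x0 : 0 < x by exact: lt_le_trans wx.
(* A margin w/2 on each side leaves room for the closed support; w <= x keeps the left end
   positive. *)
pose x1 := x - w / 2; pose x2 := x + 2 * w + w / 2.
have LE : x2 - x1 = 3 * w by rewrite /x1 /x2; lra.
have L0 : 0 < 3 * w by rewrite mulr_gt0.
exists (m * w ^- 2 * (3 * w) `^ p^-1, fun t => (x2 - x1) `^ (- p^-1) * spike x w t).
split => [||phi tphi] /=.
- apply: (@bounded_is_atom _ _ _ _ x1 x (x + 2 * w) x2) => //.
  + exact: measurable_spike.
  + by rewrite /x1; apply/andP; split; lra.
  + by rewrite /x2; lra.
  + by rewrite /x1 /x2; lra.
  + exact: spike_norm.
  + by move=> t; exact: spike_out.
  + have c1 : continuous (cst 1 : R -> R) by move=> t; exact: cvg_cst.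
    have [_] := spike_Rintegral x0 w0 c1.
    under eq_Rintegral do rewrite mulr1.
    move=> ->; rewrite !(Rintegral_itvoo_is_derive (F := id))//; lra.
- rewrite ger0_norm ?mulr_ge0 ?powR_ge0 ?invr_ge0 ?exprn_ge0 ?(ltW w0)//.
  have w2 : 0 <= w ^- 2 by rewrite invr_ge0 exprn_ge0 ?ltW.
  rewrite powRM ?powR_ge0 ?mulr_ge0// -powRrM mulVf ?gt_eqF// powRr1 ?(ltW L0)//.
  rewrite powRM// -powR_invn ?(ltW w0)// -powRrM powRD; last by rewrite (gt_eqF w0) implybT.
  rewrite powRr1 ?(ltW w0)// mulNr; ring.
have [F dF] := continuous_antiderivative (@continuous_derive1n _ phi 0 tphi).
have [eta etaI e] := second_difference tphi x0 w0 dF.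
exists eta => //.
have [ig eg] := spike_Rintegral x0 w0 (@continuous_derive1n _ phi 0 tphi).
rewrite pairing_scale// eg.
have FE (a b : R) : 0 < a -> a < b -> \int[mu]_(t in `]a, b[) phi t = F b - F a.
  move=> a0 ab; apply: Rintegral_itvoo_is_derive => //.
    by move=> t /andP[at_ _]; apply: dF; exact: lt_le_trans at_.
  exact: (@continuous_derive1n _ phi 0 tphi).
rewrite !FE ?addr_gt0//; [|lra|lra].
rewrite e LE powRN.
have P0 : (3 * w) `^ p^-1 != 0 by rewrite gt_eqF// powR_gt0.
have w0' : w != 0 by rewrite gt_eqF.
by rewrite /=; field; apply/andP; split.
Qed.

(** The atom is a multiple of 3 - 2t on (1, 2), the derivative of the parabola (t - 1)(2 - t), which
    vanishes at both ends. Hence the mean is 0 and the Hardy transform is the parabola divided by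
    x. *)
Lemma root_atom (p : R) q : 0 < p -> (1 <= q)%E -> exists d : R * (R -> R),
  [/\ is_atom p q d.2,
    forall x, 1 < x < 2 -> d.1 * hardy d.2 x = x^-1 * ((x - 1) * (2 - x)) &
    forall phi, test_function phi -> d.1 * pairing d.2 phi =
      \int[mu]_(t in `]1, 2[) ((3 - 2 * t) * phi t)].
Proof.
move=> p0 q1.
pose g t : R := \1_(`]1, 2[%classic : set R) t * (3 - 2 * t).
have cl : continuous (fun t : R => 3 - 2 * t).
  move=> t; apply: cvgB; first exact: cvg_cst.
  by apply: cvgM; [exact: cvg_cst|exact: cvg_id].
have drho (t : R) : is_derive t 1 (fun t : R => (t - 1) * (2 - t)) (3 - 2 * t).
  by apply: is_derive_eq; rewrite /GRing.scale/=; ring.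
have LE : 5 / 2 - 1 / 2 = 2 :> R by lra.
(* The interval (1/2, 5/2) has length 2, so the coefficient cancels the normalisation of the
   atom. *)
exists (2 `^ p^-1, fun t => (5 / 2 - 1 / 2) `^ (- p^-1) * g t).
have P0 : 2 `^ p^-1 != 0 :> R by rewrite gt_eqF// powR_gt0.
split => [|x /andP[x1 x2]|phi tphi] /=.
- apply: (@bounded_is_atom _ _ _ _ (1 / 2) 1 2 (5 / 2)) => //; try lra.
  + apply: measurable_funM; first exact: measurable_indic.
    exact: continuous_measurable_fun.
  + move=> t; rewrite /g indicE; case: (boolP (t \in _)) => [|_].
      move=> /set_mem/=; rewrite in_itv/= => /andP[t1 t2].
      by rewrite mul1r ler_norml; apply/andP; split; lra.
    by rewrite mul0r normr0.
  + move=> t ht; rewrite /g indicE memNset ?mul0r//= in_itv/= => /andP[t1 t2].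
    by move/negP: ht; apply; rewrite !ltW.
  + have [_ ->] := integrable_indicM 2 ltr01 cl.
    rewrite (Rintegral_itvoo_is_derive (F := fun t => (t - 1) * (2 - t)))//; lra.
- have sub : `]1, x[ `<=` `]0, x[%classic.
    by move=> t /=; rewrite !in_itv/= => /andP[t1 ->]; rewrite (lt_trans ltr01 t1).
  rewrite /hardy (@Rintegral_subset_eq0 _ `]0, x[ `]1, x[)//; last first.
    move=> t/=; rewrite !in_itv/= => /andP[t0 tx]; rewrite tx andbT => /negP t1.
    by rewrite /g indicE memNset ?mul0r ?mulr0//= in_itv/= (negbTE t1).
  have -> : \int[mu]_(t in `]1, x[) ((5 / 2 - 1 / 2) `^ (- p^-1) * g t) =
      (5 / 2 - 1 / 2) `^ (- p^-1) * \int[mu]_(t in `]1, x[) (3 - 2 * t).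
    have ig : mu.-integrable `[1, x] (EFin \o (fun t : R => 3 - 2 * t)).
      apply: continuous_compact_integrable; first exact: segment_compact.
      exact: continuous_subspaceT.
    rewrite -RintegralZl//; last first.
      by apply: integrableS ig => //; exact: subset_itv_oo_cc.
    apply: eq_Rintegral => t /set_mem/=; rewrite in_itv/= => /andP[t1 tx].
    by rewrite /g indicE mem_set/= ?mul1r// in_itv/= t1 (lt_trans tx).
  rewrite (Rintegral_itvoo_is_derive (F := fun t => (t - 1) * (2 - t)))//.
  rewrite LE powRN subrr mul0r subr0 mulrCA; congr (_ * _).
  by rewrite mulVKf.
- have cp : continuous (fun t : R => (3 - 2 * t) * phi t).
    move=> t; apply: cvgM; first exact: cl.
    exact: (@continuous_derive1n _ phi 0 tphi).
  have [ig eg] := integrable_indicM 2 ltr01 cp.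
  have E : (fun t => g t * phi t) =
     (fun t => \1_(`]1, 2[%classic : set R) t * ((3 - 2 * t) * phi t)).
    by apply/funext => t; rewrite /g mulrA.
  by rewrite pairing_scale E// eg LE powRN mulVKf.
Qed.

End spikes.

(** * The binary tree of spikes *)

Section spike_tree.
Context {R : realType}.
Notation mu := (@lebesgue_measure R).

(* The nodes of the infinite binary tree are numbered from 0, the children of
   [k] being [2k + 1] and [2k + 2]. Splitting the nodes [0 .. N-1] one after the other
   replaces the root by the frontier [N .. 2N]. *)
Lemma sum_heap_telescope (P : nat -> R) N :
  \sum_(0 <= k < N) (P k.*2.+1 + P k.*2.+2 - P k) =
  \sum_(N <= m < N.*2.+1) P m - P 0%N.
Proof.
elim: N => [|N ih]; first by rewrite big_nil big_nat1 subrr.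
rewrite big_nat_recr//= ih doubleS.
rewrite [in RHS]big_nat_recr/=; last lia.
rewrite [in RHS]big_nat_recr/=; last lia.
rewrite [in LHS]big_ltn; last lia.
set S := \sum_(_ <= _ < _) _.
ring.
Qed.

(** Telescoping leaves the sum of [P] over the frontier minus its root value. As [F] is additive and
    [P] starts at [- F 0], this is the frontier sum of [P + F], bounded by C times the largest
    frontier length times the total length, hence O(1/N). *)
Lemma heap_series_cvg0 (P F len : nat -> R) (C : R) : 0 <= C ->
  (forall n, F n.*2.+1 + F n.*2.+2 = F n) ->
  (forall n, len n.*2.+1 + len n.*2.+2 = len n) ->
  (forall n, 0 <= len n <= 2 / n.+1%:R) ->
  (forall n, `|P n + F n| <= C * len n ^+ 2) -> P 0%N = - F 0%N ->
  series (fun n => P n.*2.+1 + P n.*2.+2 - P n) @ \oo --> 0.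
Proof.
move=> C0 Fadd lenadd len_le PF P0.
(* An additive function on the tree has the same sum over every frontier as at the root. *)
have additive (H : nat -> R) N : (forall n, H n.*2.+1 + H n.*2.+2 = H n) ->
    \sum_(N <= m < N.*2.+1) H m = H 0%N.
  move=> Hadd; apply/eqP; rewrite -subr_eq0 -sum_heap_telescope big1// => k _.
  by rewrite Hadd subrr.
have sE N : series (fun n => P n.*2.+1 + P n.*2.+2 - P n) N =
    \sum_(N <= m < N.*2.+1) (P m + F m).
  by rewrite /series/= sum_heap_telescope big_split/= (additive F)// P0 opprK.
have sN N : `|series (fun n => P n.*2.+1 + P n.*2.+2 - P n) N| <=
    (2 * C * len 0%N) * N.+1%:R^-1.
  rewrite sE; apply: le_trans (ler_norm_sum _ _ _) _.
  rewrite -(additive len N lenadd) mulr_sumr mulr_suml.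
  apply: ler_sum_nat => m /andP[Nm _]; apply: le_trans (PF m) _.
  have /andP[l0 l1] := len_le m.
  rewrite [2 * C]mulrC -!mulrA ler_wpM2l// expr2 mulrCA ler_wpM2l//.
  apply: le_trans l1 _.
  by rewrite ler_wpM2l// lef_pV2 ?posrE// ler_nat ltnS.
apply/cvgr0Pnorm_le => e e0.
have l00 : 0 <= len 0%N by have /andP[] := len_le 0%N.
have K0 : 0 < 2 * C * len 0%N + 1 by rewrite ltr_wpDl// !mulr_ge0.
have eK : 0 < e / (2 * C * len 0%N + 1) by rewrite divr_gt0.
apply: filterS (near_natSinv_lt eK) => N hN.
apply: le_trans (sN N) _.
apply: (@le_trans _ _ ((2 * C * len 0%N + 1) * N.+1%:R^-1)).
  by rewrite ler_wpM2r ?invr_ge0// lerDl.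
by rewrite mulrC -ler_pdivlMr// ltW.
Qed.

(* Node [n] carries the dyadic subinterval of [1, 2] with left endpoint
   [node_lo n] and length [node_len n]. *)
Definition node_log (n : nat) := trunc_log 2 n.+1.
Definition node_len (n : nat) : R := (2 ^+ node_log n)^-1.
Definition node_lo (n : nat) : R := n.+1%:R * node_len n.

Lemma node_log_left n : node_log n.*2.+1 = (node_log n).+1.
Proof. by rewrite /node_log -doubleS trunc_log2S ?doubleK// -[2%N]/1.*2 leq_double. Qed.

Lemma node_log_right n : node_log n.*2.+2 = (node_log n).+1.
Proof.
rewrite /node_log -doubleS trunc_log2S /= ?uphalf_double//.
Qed.

Lemma node_len_gt0 n : 0 < node_len n.
Proof. by rewrite invr_gt0 exprn_gt0. Qed.

Lemma node_len_left n : node_len n.*2.+1 = node_len n / 2.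
Proof. by rewrite /node_len node_log_left exprS invfM mulrC. Qed.

Lemma node_len_right n : node_len n.*2.+2 = node_len n / 2.
Proof. by rewrite /node_len node_log_right exprS invfM mulrC. Qed.

Lemma node_lo_left n : node_lo n.*2.+1 = node_lo n.
Proof.
by rewrite /node_lo node_len_left -doubleS -muln2 natrM; field.
Qed.

Lemma node_lo_right n : node_lo n.*2.+2 = node_lo n + node_len n / 2.
Proof.
by rewrite /node_lo node_len_right -doubleS -addn1 natrD -muln2 natrM; field.
Qed.

Lemma node_len_le n : node_len n <= 2 / n.+1%:R.
Proof.
have /andP[_ h] := trunc_log_bounds (isT : 1 < 2)%N (ltn0Sn n).
rewrite /node_len ler_pdivlMr// mulrC ler_pdivrMr ?exprn_gt0//.
by rewrite -exprS -natrX ler_nat ltnW.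
Qed.

Lemma node_lo_ge1 n : 1 <= node_lo n.
Proof.
have /andP[h _] := trunc_log_bounds (isT : 1 < 2)%N (ltn0Sn n).
by rewrite /node_lo /node_len ler_pdivlMr ?exprn_gt0// mul1r -natrX ler_nat.
Qed.

Lemma node_hi_le2 n : node_lo n + node_len n <= 2.
Proof.
have /andP[_ h] := trunc_log_bounds (isT : 1 < 2)%N (ltn0Sn n).
rewrite /node_lo -{2}[node_len n]mul1r -mulrDl /node_len ler_pdivrMr ?exprn_gt0//.
by rewrite -exprS -natrX natr1 ler_nat.
Qed.

Lemma node_len_ge n : (2 ^ n.+1)%:R^-1 <= node_len n.
Proof.
have /andP[h _] := trunc_log_bounds (isT : 1 < 2)%N (ltn0Sn n).
rewrite /node_len lef_pV2 ?posrE ?exprn_gt0 ?ltr0n ?expn_gt0//.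
rewrite -natrX ler_nat; apply: leq_trans h _; exact/ltnW/ltn_expl.
Qed.

(* The factor [w^(1 - 2p)] in the cost of a spike is made equal to [e / 2^(n+1)];
   this is where [p < 1/2] is needed. The masses of the spikes are those of the
   parabola [(t - 1)(2 - t)], the primitive of the root atom. *)
Lemma spike_tree (p : R) q (e : R) : 0 < p -> 2 * p < 1 -> (1 <= q)%E ->
  0 < e <= 1 -> exists S : nat -> R * (R -> R),
  [/\ forall n, is_atom p q (S n).2,
    forall x, 1 < x < 2 -> (S 0%N).1 * hardy (S 0%N).2 x = x^-1 * ((x - 1) * (2 - x)),
    forall n, `|(S n.+1).1| `^ p <= 3 * e / (2 ^ n.+2)%:R &
    forall phi, test_function phi ->
      let P n := (S n).1 * pairing (S n).2 phi in
      P @ \oo --> 0 /\ series (fun n => P n.*2.+1 + P n.*2.+2 - P n) @ \oo --> 0].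
Proof.
move=> p0 p2 q1 /andP[e0 e1].
have r0 : 0 < 1 - 2 * p by rewrite subr_gt0.
pose b n := e / (2 ^ n.+1)%:R.
have b0 n : 0 < b n by rewrite divr_gt0// ltr0n expn_gt0.
have b_le n : b n <= node_len n.
  apply: le_trans (node_len_ge n).
  by rewrite ler_piMl// invr_ge0.
pose w n := b n `^ (1 - 2 * p)^-1.
have w0 n : 0 < w n by exact: powR_gt0.
have wr n : w n `^ (1 - 2 * p) = b n.
  by rewrite -powRrM mulVf ?gt_eqF// powRr1// ltW.
have len1 n : node_len n <= 1.
  have := node_lo_ge1 n; have := node_hi_le2 n; lra.
(* The exponent 1/(1 - 2p) is at least 1 and [b n <= 1], so [w n <= b n]. *)
have w_le n : w n <= node_len n.
  apply: le_trans (b_le n); apply: ge1r_powR.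
    by rewrite b0 (le_trans (b_le n)).
  by rewrite -[leLHS]invr1 lef_pV2 ?posrE// gerBl mulr_ge0// ltW.
pose rho (t : R) := (t - 1) * (2 - t).
(* A left-endpoint Riemann approximation to the area under the parabola over the node. *)
pose m n := rho (node_lo n) * node_len n.
have lo_in n : 1 <= node_lo n <= 2.
  rewrite node_lo_ge1/=; have := node_hi_le2 n; have := node_len_gt0 n; lra.
have rho_in n : 0 <= rho (node_lo n) <= 1.
  by rewrite /rho; have /andP[h1 h2] := lo_in n; apply/andP; split; nra.
have m0 n : 0 <= m n.
  by rewrite mulr_ge0 ?(ltW (node_len_gt0 n))//; have /andP[] := rho_in n.
have m_le n : m n <= node_len n.
  by rewrite ler_piMl ?(ltW (node_len_gt0 n))//; have /andP[] := rho_in n.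
have /choice[D HD] : forall n, exists d : R * (R -> R),
  [/\ is_atom p q d.2, `|d.1| `^ p = 3 * m n `^ p * w n `^ (1 - 2 * p) &
    forall phi, test_function phi -> exists2 eta, node_lo n < eta < node_lo n + 2 * w n &
      d.1 * pairing d.2 phi = - (m n * derive1n 1 phi eta)].
  move=> n; apply: spike_atom => //; rewrite w0/=.
  by apply: le_trans (w_le n) _; apply: le_trans (len1 n) (node_lo_ge1 n).
have [d0 [atom0 hardy0 pair0]] := root_atom p0 q1.
exists (fun n => if n is 0%N then d0 else D n); split => //.
- by case=> [//|n]; have [] := HD n.+1.
- move=> n; have [_ -> _] := HD n.+1; rewrite wr /b mulrA ler_wpM2r ?invr_ge0//.
  rewrite ler_wpM2r ?(ltW e0)// ler_piMr//.
  apply: (@le_trans _ _ (1 `^ p)); last by rewrite powR1.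
  apply: ge0_ler_powR; rewrite ?nnegrE ?(ltW p0)//.
  exact: le_trans (m_le _) (len1 _).
move=> phi tphi P.
have [M1 M1_gt0 HM1] := derive1n_bounded 1 tphi.
have [M2 M2_gt0 HM2] := derive1n_lipschitz 1 tphi.
have cphi : continuous (fun t : R => (3 - 2 * t) * phi t).
  move=> t; apply: cvgM; last exact: (@continuous_derive1n _ phi 0 tphi).
  apply: cvgB; first exact: cvg_cst.
  by apply: cvgM; [exact: cvg_cst|exact: cvg_id].
have [Q dQ] := continuous_antiderivative cphi.
(* Integration by parts: [G] is a primitive of rho phi', so the increment [F n] over a node is
   nearly minus the pairing with its spike. *)
pose G t := rho t * phi t - Q t.
have dG (t : R) : 0 < t -> is_derive t 1 G (rho t * derive1n 1 phi t).
  move=> t0; have dr : is_derive t 1 rho (3 - 2 * t).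
    by apply: is_derive_eq; rewrite /GRing.scale/=; ring.
  have := is_deriveB (is_deriveM dr (is_derive_derive1n 0 t tphi)) (dQ t t0).
  congr (is_derive _ _ _ _).
  by rewrite /GRing.scale/=; ring.
pose F n := G (node_lo n + node_len n) - G (node_lo n).
have log0 : node_log 0 = 0%N by [].
have len0 : node_len 0 = 1 :> R by rewrite /node_len log0 expr0 invr1.
have lo0 : node_lo 0 = 1 :> R by rewrite /node_lo len0 mulr1.
(* Exact at the root, since [rho] vanishes at 1 and 2. *)
have P0 : P 0%N = - F 0%N.
  rewrite /P /= pair0// /F len0 lo0 /G /rho.
  have -> : \int[mu]_(t in `]1, 2[) ((3 - 2 * t) * phi t) = Q 2 - Q 1.
    apply: Rintegral_itvoo_is_derive => //; first by rewrite ltr1n.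
    by move=> t /andP[t1 _]; apply: dQ; exact: lt_le_trans t1.
  rewrite (_ : 1 + 1 = 2)//; ring.
(* On the node [rho] varies by at most its length l. The points [xi] and [eta] are within 2l of each
   other because w <= l, which gives the term 2 M2. *)
have PF n : `|P n + F n| <= (M1 + 2 * M2) * node_len n ^+ 2.
  case: n => [|n].
    rewrite P0 addNr normr0 mulr_ge0 ?exprn_ge0 ?(ltW (node_len_gt0 _))//.
    by rewrite addr_ge0 ?mulr_ge0// ltW.
  have [_ _ /(_ _ tphi)[eta /andP[eta1 eta2] PE]] := HD n.+1.
  rewrite /P PE /F /m.
  have := node_lo_ge1 n.+1; have := node_hi_le2 n.+1; have := node_len_gt0 n.+1.
  have := w_le n.+1; have := rho_in n.+1; move: eta1 eta2.
  set x := node_lo n.+1; set l := node_len n.+1 => eta1 eta2 rx wl l0 xl x1.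
  have xxl : x < x + l by rewrite ltrDl.
  have [xi xiI ->] : exists2 xi, xi \in `]x, x + l[%R &
      G (x + l) - G x = (rho xi * derive1n 1 phi xi) * (x + l - x).
    apply: (@MVT R G (fun z => rho z * derive1n 1 phi z) x (x + l) xxl) => [z|].
      by rewrite in_itv/= => /andP[xz _]; apply: dG; lra.
    apply: continuous_in_subspaceT => z /set_mem/=; rewrite in_itv/= => /andP[xz _].
    have z0 : 0 < z by lra.
    apply: differentiable_continuous; apply/derivable1_diffP.
    by have [] := dG z z0.
  move: xiI; rewrite in_itv/= => /andP[xxi xixl].
  have -> : - (rho x * l * derive1n 1 phi eta) + rho xi * derive1n 1 phi xi * (x + l - x) =
     l * ((rho xi - rho x) * derive1n 1 phi xi +
          rho x * (derive1n 1 phi xi - derive1n 1 phi eta)) by ring.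
  rewrite normrM (gtr0_norm l0) expr2 mulrCA ler_wpM2l ?(ltW l0)//.
  apply: le_trans (ler_normD _ _) _; rewrite [leRHS]mulrDl; apply: lerD; rewrite normrM.
    rewrite mulrC; apply: ler_pM => //.
    have -> : rho xi - rho x = (xi - x) * (3 - xi - x) by rewrite /rho; ring.
    rewrite normrM -[leRHS]mulr1; apply: ler_pM => //.
      by rewrite ger0_norm; lra.
    by rewrite ler_norml; apply/andP; split; lra.
  case/andP: rx => rx0 rx1.
  rewrite (ger0_norm rx0) -[leRHS]mul1r; apply: ler_pM => //.
  apply: le_trans (HM2 _ _) _; rewrite [2 * M2]mulrC -mulrA ler_wpM2l ?(ltW M2_gt0)//.
  by rewrite ler_norml; apply/andP; split; lra.
split.
  apply/cvgr0Pnorm_le => d dgt0.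
  have dK : 0 < d / (2 * M1) by rewrite divr_gt0// mulr_gt0.
  near=> n.
  have n0 : (0 < n)%N by near: n; exact: nbhs_infty_gt.
  have nd : n.+1%:R^-1 < d / (2 * M1) by near: n; exact: near_natSinv_lt.
  have -> : n = n.-1.+1 by rewrite prednK.
  have [_ _ /(_ _ tphi)[eta _ PE]] := HD n.-1.+1.
  rewrite /P PE prednK// normrN normrM (ger0_norm (m0 n)).
  apply: (@le_trans _ _ (node_len n * M1)); first by apply: ler_pM.
  apply: (@le_trans _ _ (2 / n.+1%:R * M1)).
    by rewrite ler_wpM2r ?(ltW M1_gt0)// node_len_le.
  rewrite mulrAC mulrC -ler_pdivlMr ?mulr_gt0//; exact: ltW.
apply: (@heap_series_cvg0 P F node_len (M1 + 2 * M2)) => //.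
- by rewrite addr_ge0 ?mulr_ge0// ltW.
- move=> n; rewrite /F node_lo_left node_lo_right node_len_left node_len_right.
  have -> : node_lo n + node_len n / 2 + node_len n / 2 = node_lo n + node_len n by lra.
  by ring.
- by move=> n; rewrite node_len_left node_len_right -splitr.
- by move=> n; rewrite (ltW (node_len_gt0 n)) node_len_le.
Unshelve. all: by end_near. Qed.

End spike_tree.

(** * Nonexistence of the transform for p < 1/2 *)

Section below_half.
Context {R : realType}.
Notation mu := (@lebesgue_measure R).

Lemma interleave_forall {T : Type} (Q : T -> Prop) (u v : nat -> T) :
  (forall n, Q (u n)) -> (forall n, Q (v n)) -> forall n, Q (interleave u v n).
Proof. by move=> Qu Qv n; rewrite /interleave; case: ifP. Qed.

Lemma interleave_add {V : nmodType} (u v s t : nat -> V) n :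
  interleave u v n + interleave s t n =
  interleave (fun k => u k + s k) (fun k => v k + t k) n.
Proof. by rewrite /interleave; case: ifP. Qed.

(** Block n lists the terms in the order [u n], [s n], [v n], [t n]. *)
Definition interleave4 {T : Type} (u v s t : nat -> T) :=
  interleave (interleave u v) (interleave s t).

Lemma comp_interleave4 {T U : Type} (g : T -> U) (u v s t : nat -> T) :
  g \o interleave4 u v s t = interleave4 (g \o u) (g \o v) (g \o s) (g \o t).
Proof. by rewrite /interleave4 !comp_interleave. Qed.

Lemma sum_interleave4 (V : nmodType) (u v s t : nat -> V) N :
  \sum_(0 <= k < N.*2.*2) interleave4 u v s t k =
  \sum_(0 <= k < N) (u k + s k + (v k + t k)).
Proof.
rewrite sum_interleave_double; under eq_bigr do rewrite interleave_add.
exact: sum_interleave_double.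
Qed.

Lemma leq_double_self n : (n <= n.*2)%N.
Proof. by rewrite -addnn leq_addr. Qed.

Lemma cvg_reindex (u : nat -> R) (l : R) (g : nat -> nat) :
  (forall n, (n <= g n)%N) -> u @ \oo --> l -> (fun n => u (g n)) @ \oo --> l.
Proof.
move=> ng /cvgrPdist_lt ul; apply/cvgrPdist_lt => e e0.
have [N _ HN] := ul _ e0; exists N => // n /= Nn; apply: HN => /=.
exact: leq_trans Nn (ng n).
Qed.

Lemma cvg_interleave (u v : nat -> R) (l : R) : u @ \oo --> l -> v @ \oo --> l ->
  interleave u v @ \oo --> l.
Proof.
move=> /cvgrPdist_lt ul /cvgrPdist_lt vl; apply/cvgrPdist_lt => e e0.
have [N1 _ H1] := ul _ e0; have [N2 _ H2] := vl _ e0.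
exists (maxn N1 N2).*2 => // n /= nN.
have mN : (maxn N1 N2 <= n./2)%N by rewrite -(doubleK (maxn N1 N2)); exact: half_leq.
move: mN; rewrite geq_max => /andP[mN1 mN2].
by rewrite /interleave; case: ifP => _; [exact: H2|exact: H1].
Qed.

Lemma cvg_series_interleave4 (u v s t : nat -> R) (l : R) :
  u @ \oo --> 0 -> v @ \oo --> 0 -> s @ \oo --> 0 ->
  series (fun n => u n + s n + (v n + t n)) @ \oo --> l ->
  series (interleave4 u v s t) @ \oo --> l.
Proof.
move=> u0 v0 s0 h; apply: cvg_interleave_sum; first exact: cvg_interleave.
have -> : (fun n => interleave u v n + interleave s t n) =
    interleave (fun k => u k + s k) (fun k => v k + t k).
  by apply/funext => n; exact: interleave_add.
by apply: cvg_interleave_sum h; rewrite -[0]addr0; exact: cvgD.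
Qed.

Lemma nneseries_interleave4_le (u v s t : nat -> \bar R) :
  (forall n, (0 <= u n)%E) -> (forall n, (0 <= v n)%E) ->
  (forall n, (0 <= s n)%E) -> (forall n, (0 <= t n)%E) ->
  (\sum_(0 <= k <oo) interleave4 u v s t k <=
   \sum_(0 <= k <oo) u k + \sum_(0 <= k <oo) v k +
   (\sum_(0 <= k <oo) s k + \sum_(0 <= k <oo) t k))%E.
Proof.
move=> u0 v0 s0 t0; apply: le_trans (nneseries_interleave_le _ _) _.
- exact: (interleave_forall (Q := fun x => (0 <= x)%E)).
- exact: (interleave_forall (Q := fun x => (0 <= x)%E)).
- by apply: leeD; exact: nneseries_interleave_le.
Qed.

Lemma nneseries_le_geometric (u : nat -> R) (c : R) : 0 <= c ->
  (forall n, u n <= c / (2 ^ n.+1)%:R) -> (forall n, 0 <= u n) ->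
  (\sum_(0 <= n <oo) (u n)%:E <= c%:E)%E.
Proof.
move=> c0 uc u0; apply: le_trans (epsilon_trick0 xpredT c0).
by apply: lee_nneseries => n _ *; rewrite lee_fin.
Qed.

(** Splitting every node of the tree adds a zero distribution to a decomposition of [f]. If both
    Hardy series had sum [h], the spikes alone would reproduce the transform of the root, in blocks
    of four terms, at cost at most 9e; this contradicts the uniform integral bound once e is
    small. *)
Lemma no_hardy_transform (p : R) q f (h : R -> R) : 0 < p -> 2 * p < 1 ->
  (1 <= q)%E -> in_Hpq0 p q f -> ~ is_hardy_transform p q f h.
Proof.
move=> p0 p2 q1 [lam [a dec]] [mh hE].
have p01 : 0 < p <= 1 by rewrite p0/=; lra.
have pq : (p%:E < q)%E by apply: lt_le_trans q1; rewrite lte_fin; lra.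
pose K := hardy_atom_const (p * inv_exponent q) p.
have K0 : 0 < K.
  by apply: hardy_atom_const_gt0; have /andP[] := exponent_lt1 p0 q1 pq.
(* On [5/4, 7/4], of length 1/2, (x - 1)(2 - x) >= 3/16 and x < 2, so the root transform is at least
   3/32. *)
pose c0 : R := (3 / 32) `^ p / 2.
have c0_gt0 : 0 < c0 by rewrite divr_gt0// powR_gt0//; lra.
(* The factor 18 = 2 * 9 makes 9 e K at most c0/2. *)
pose e := Num.min 1 (c0 / (18 * K)).
have e01 : 0 < e <= 1.
  by rewrite /e lt_min ltr01 divr_gt0 ?mulr_gt0//= ge_min lexx.
have /andP[e0 _] := e01.
have eK : K * (9 * e) < c0.
  have : e <= c0 / (18 * K) by rewrite /e ge_min lexx orbT.
  rewrite ler_pdivlMr ?mulr_gt0//; nra.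
have [S [atomS hardyS costS pairS]] := spike_tree p0 p2 q1 e01.
(* [A] is the given decomposition, [B] removes node n, and [C] and [D] insert its two children. *)
pose A n := (lam n, a n).
pose B n := (- (S n).1, (S n).2).
pose C n := S n.*2.+1.
pose D n := S n.*2.+2.
pose Z := interleave4 A B C D.
pose cost (d : R * (R -> R)) : \bar R := (`|d.1| `^ p)%:E.
have cost_ge0 d : (0 <= cost d)%E by rewrite lee_fin powR_ge0.
have [atoms costlam pairf] := dec.
have sum_lower n k : (0 < n)%N -> (k <= n)%N ->
    `|(S n).1| `^ p <= 3 * e / (2 ^ k.+1)%:R.
  case: n => // n _ kn; apply: le_trans (costS n) _.
  rewrite ler_wpM2l ?mulr_ge0 ?(ltW e0)// lef_pV2 ?posrE ?ltr0n ?expn_gt0//.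
  by rewrite ler_nat leq_exp2l.
have costC : (\sum_(0 <= k <oo) cost (C k) <= (3 * e)%:E)%E.
  apply: nneseries_le_geometric => [|n|n]; rewrite ?powR_ge0 ?mulr_ge0 ?(ltW e0)//.
  exact: (sum_lower n.*2.+1 n (ltn0Sn _) (leqW (leq_double_self n))).
have costD : (\sum_(0 <= k <oo) cost (D k) <= (3 * e)%:E)%E.
  apply: nneseries_le_geometric => [|n|n]; rewrite ?powR_ge0 ?mulr_ge0 ?(ltW e0)//.
  exact: (sum_lower n.*2.+2 n (ltn0Sn _) (leqW (leqW (leq_double_self n)))).
have decZ : atomic_decomposition p q f (fun n => (Z n).1) (fun n => (Z n).2).
  split.
  - have Q2 := @interleave_forall _ (fun d : R * (R -> R) => is_atom p q d.2).
    by apply: (Q2); apply: Q2 => n; rewrite /A /B /C /D/=.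
  - apply: (@le_lt_trans _ _ (\sum_(0 <= k <oo) interleave4 (cost \o A) (cost \o B)
        (cost \o C) (cost \o D) k)%E).
      by rewrite -comp_interleave4.
    apply: le_lt_trans (nneseries_interleave4_le _ _ _ _) _;
      [by move=> n; exact: cost_ge0..|].
    apply: lte_add_pinfty; apply: lte_add_pinfty.
    + exact: costlam.
    (* The root has no small cost; the factor 2 offsets the geometric weight 1/2 at index 0. *)
    + pose c := 3 * e + 2 * `|(S 0%N).1| `^ p.
      have c0' : 0 <= c by rewrite addr_ge0 ?mulr_ge0 ?powR_ge0// ltW.
      apply: (@le_lt_trans _ _ c%:E); last exact: ltry.
      apply: nneseries_le_geometric => [//|n|n]; last exact: powR_ge0.
      case: n => [|n]; rewrite /= normrN.
        rewrite expn1 ler_pdivlMr//; rewrite /c; nra.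
      apply: le_trans (costS n) _.
      by rewrite ler_wpM2r ?invr_ge0// lerDl mulr_ge0 ?powR_ge0.
    + exact: le_lt_trans costC (ltry _).
    + exact: le_lt_trans costD (ltry _).
  - move=> phi tphi.
    pose val (d : R * (R -> R)) := d.1 * pairing d.2 phi.
    have [P0 Psum] := pairS phi tphi.
    have cval : series (interleave4 (val \o A) (val \o B) (val \o C) (val \o D)) @ \oo
        --> f phi.
      have fA := pairf phi tphi.
      apply: cvg_series_interleave4.
      + exact: cvg_series_cvg_0 (cvgP _ fA).
      + rewrite -oppr0 (_ : val \o B = \- (val \o S)); first exact: cvgN.
        by apply/funext => n; rewrite /val /= mulNr.
      + exact: (cvg_reindex (fun n => leqW (leq_double_self n)) P0).
      have -> : series (fun n => (val \o A) n + (val \o C) n + ((val \o B) n + (val \o D) n)) =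
          series (fun k => lam k * pairing (a k) phi) \+
          series (fun n => val (S n.*2.+1) + val (S n.*2.+2) - val (S n)).
        apply/funext => n; rewrite /series/= -big_split/=; apply: eq_bigr => k _.
        by rewrite /val /A /B /C /D/= mulNr; ring.
      by rewrite -[f phi]addr0; exact: cvgD.
    by rewrite -comp_interleave4 in cval.
(* Zero coefficients erase the given decomposition and the root but keep the indexing, so that [W]
   and [Z] can be compared block by block. *)
pose A0 n : R * (R -> R) := (0, a n).
pose B0 n := (if n == 0%N then 0 else - (S n).1, (S n).2).
pose W := interleave4 A0 B0 C D.
pose g (x : R) : R := 3 / 32 * \1_(`[5 / 4, 7 / 4]%classic : set R) x.
have mg : measurable_fun (@Rpos R) g.
  by apply: measurable_funTS; apply: measurable_funM => //; exact: measurable_indic.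
have costW : (\sum_(0 <= k <oo) cost (W k) <= (9 * e)%:E)%E.
  apply: (@le_trans _ _ (\sum_(0 <= k <oo) interleave4 (cost \o A0) (cost \o B0)
      (cost \o C) (cost \o D) k)%E).
    by rewrite -comp_interleave4.
  apply: le_trans (nneseries_interleave4_le _ _ _ _) _;
    [by move=> n; exact: cost_ge0..|].
  rewrite (_ : 9 * e = 0 + 3 * e + (3 * e + 3 * e)); last ring.
  rewrite !EFinD; apply: leeD; apply: leeD; [| |exact: costC|exact: costD].
    by rewrite eseries0// => k _ _; rewrite /= /cost/= normr0 powR0 ?gt_eqF.
  apply: nneseries_le_geometric => [|n|n]; rewrite ?powR_ge0 ?mulr_ge0 ?(ltW e0)//.
  rewrite /=; case: eqP => [_|/eqP].
    by rewrite normr0 powR0 ?gt_eqF// divr_ge0 ?mulr_ge0 ?(ltW e0).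
  by rewrite normrN -lt0n => n0; apply: sum_lower.
(* Over whole blocks, the sum of [W] is that of [Z] minus that of the given series plus the root
   term; the first two have the same limit [h x]. *)
have limW : {ae mu, forall x, 0 < x ->
   exists2 l, (fun n => series (fun k => (W k).1 * hardy (W k).2 x) n.*2.*2) @ \oo --> l &
       `|g x| <= `|l|}.
  have := hE _ _ decZ; have := hE _ _ dec.
  apply: (@filterS2 _ _ (ae_filter_ringOfSetsType mu)) => x hA hZ x0.
  have {}hA := hA x0; have {}hZ := hZ x0.
  pose hv (d : R * (R -> R)) := d.1 * hardy d.2 x.
  exists (hv (S 0%N)).
    have : (fun n => series (fun k => (Z k).1 * hardy (Z k).2 x) n.*2.*2 -
        series (fun k => lam k * hardy (a k) x) n + hv (S 0%N)) @ \oo --> hv (S 0%N).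
      rewrite -[X in _ --> X]add0r -(subrr (h x)).
      apply: cvgD; last exact: cvg_cst.
      apply: cvgB => //.
      have h4 n : (n <= n.*2.*2)%N := leq_trans (leq_double_self n) (leq_double_self _).
      exact: (cvg_reindex h4 hZ).
    apply: cvg_trans; apply: near_eq_cvg.
    (* The root is removed in block 0, so the identity starts with n = 1. *)
    exists 1%N => // -[//|n] _.
    have sE (X Y : nat -> R * (R -> R)) :
        series (fun k => (interleave4 X Y C D k).1 * hardy (interleave4 X Y C D k).2 x) n.+1.*2.*2 =
        \sum_(0 <= k < n.+1) (hv (X k) + hv (C k) + (hv (Y k) + hv (D k))).
      rewrite -(sum_interleave4 (hv \o X) (hv \o Y) (hv \o C) (hv \o D)).
      by rewrite -comp_interleave4.
    rewrite /= /Z /W !sE /series/= -sumrB !big_nat_recl//.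
    have -> : \sum_(0 <= i < n) (hv (A i.+1) + hv (C i.+1) + (hv (B i.+1) + hv (D i.+1)) -
          lam i.+1 * hardy (a i.+1) x) =
        \sum_(0 <= i < n) (hv (A0 i.+1) + hv (C i.+1) + (hv (B0 i.+1) + hv (D i.+1))).
      by apply: eq_bigr => i _; rewrite /hv /A /A0 /B /B0 /=; ring.
    by rewrite /hv /A /A0 /B /B0 /=; ring.
  rewrite /hv /g indicE; case: (boolP (x \in _)) => [|_]; last by rewrite mulr0 normr0.
  move=> /set_mem/=; rewrite in_itv/= => /andP[xl xr].
  rewrite hardyS; last by apply/andP; split; lra.
  have x1 : 3 / 32 * x <= (x - 1) * (2 - x) by nra.
  have l0 : 0 <= x^-1 * ((x - 1) * (2 - x)).
    by rewrite mulr_ge0 ?invr_ge0 ?(ltW x0)//; nra.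
  rewrite mulr1 (ger0_norm l0) ger0_norm; last lra.
  by rewrite ler_pdivlMl// mulrC.
have atomsW k : is_atom p q (W k).2.
  have Q2 := @interleave_forall _ (fun d : R * (R -> R) => is_atom p q d.2).
  by apply: (Q2); apply: Q2 => n; rewrite /A0 /B0 /C /D/=.
have intg := hardy_series_integral_le p01 q1 pq atomsW mg limW.
have : (c0%:E <= K%:E * (9 * e)%:E)%E.
  apply: le_trans (lee_wpmul2l _ costW); last by rewrite lee_fin ltW.
  apply: le_trans intg.
  have c_ge0 : 0 <= 3 / 32 :> R by lra.
  apply: (@le_trans _ _ (\int[mu]_(x in `[(5 / 4)%R, (7 / 4)%R]) (cst ((3 / 32) `^ p)%:E x))%E).
    rewrite integral_cst//= lebesgue_measure_itv/= lte_fin.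
    rewrite (_ : 5 / 4 < 7 / 4); last lra.
    rewrite -EFinB -EFinM lee_fin /c0 ler_wpM2l ?powR_ge0//; lra.
  apply: (@le_trans _ _ (\int[mu]_(x in `[(5 / 4)%R, (7 / 4)%R]) (`|g x| `^ p)%:E)%E).
    rewrite le_eqVlt; apply/orP; left; apply/eqP; apply: eq_integral => x xI.
    by rewrite /g indicE xI mulr1 ger0_norm.
  apply: ge0_subset_integral => //.
  - exact: measurable_Rpos.
  - apply/measurable_EFinP; apply: (measurableT_comp (measurable_powR p)) => //.
    exact: measurableT_comp.
  - by move=> x; rewrite /Rpos/= !in_itv/= andbT => /andP[xl _]; lra.
by rewrite -EFinM lee_fin leNgt eK.
Qed.

End below_half.

(** * The theorem *)

Lemma LnormRpos_EFin (R : realType) (p : R) (h : R -> R) : 0 < p ->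
  LnormRpos p%:E h =
  poweR (\int[@lebesgue_measure R]_(x in @Rpos R) (`|h x| `^ p)%:E)%E p^-1.
Proof.
move=> p0; rewrite LnormRpos_restrict unlock /=; congr (poweR _ _).
rewrite [RHS]integral_mkcond; apply: eq_integral => x _.
rewrite /= !patchE; case: ifP => _ //.
by rewrite normr0 powR0 ?gt_eqF.
Qed.

Theorem theorem1 (R : realType) (p : R) (q : \bar R)
    (f : (R -> R) -> R) (h : R -> R)
    (p_gt0 : 0 < p) (p_le1 : p <= 1)
    (q_ge1 : (1 <= q)%E) (p_lt_q : (p%:E < q)%E)
    (f_in : in_Hpq0 p q f) (f_neq0 : nonzero_distribution f)
    (hE : is_hardy_transform p q f h) :
  (LnormRpos p%:E h <
    (1 / (1 - p * inv_exponent q) `^ (1 / p))%:E * Hpq0_norm p q f)%E.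
Proof.
have p01 : 0 < p <= 1 by rewrite p_gt0.
have pN0 : p != 0 by rewrite gt_eqF.
have pV0 : 0 <= p^-1 by rewrite invr_ge0 ltW.
have s01 := exponent_lt1 p_gt0 q_ge1 p_lt_q; have /andP[_ s1] := s01.
set s := p * inv_exponent q in s01 s1 *.
pose K := hardy_atom_const s p.
have K0 : 0 < K by exact: hardy_atom_const_gt0.
(* The existence of a transform independent of the decomposition rules out p < 1/2. *)
have p_half : 2^-1 <= p.
  rewrite leNgt; apply/negP => p2.
  by apply: (no_hardy_transform _ _ q_ge1 f_in hE) => //; lra.
set N := Hpq0_norm p q f.
pose I := (\int[@lebesgue_measure R]_(x in @Rpos R) (`|h x| `^ p)%:E)%E.
have I0 : (0 <= I)%E by apply: integral_ge0 => x _; rewrite lee_fin powR_ge0.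
have [mh hlim] := hE.
have IK lam a : atomic_decomposition p q f lam a ->
    (I <= K%:E * \sum_(0 <= k <oo) (`|lam k| `^ p)%:E)%E.
  move=> dec; have [atoms _ _] := dec.
  apply: (hardy_series_integral_le (e := id) p01 q_ge1 p_lt_q atoms mh).
  apply: (@filterS _ _ (ae_filter_ringOfSetsType _) _ _ _ (hlim _ _ dec)) => x hx x0.
  by exists (h x) => //; exact: hx.
have sum_ge0 (lam : nat -> R) : (0 <= \sum_(0 <= k <oo) (`|lam k| `^ p)%:E)%E.
  by apply: nneseries_ge0 => k _ _; rewrite lee_fin powR_ge0.
have mono (x y : \bar R) : (0 <= x)%E -> (x <= y)%E -> (x `^ p^-1 <= y `^ p^-1)%E.
  move=> x0 xy; apply: gt0_ler_poweR => //; rewrite in_itv/= leey andbT//.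
  exact: le_trans x0 xy.
have Nfin : (N < +oo)%E.
  have [lam [a dec]] := f_in; have [_ fin _] := dec.
  apply: le_lt_trans (poweR_lty p^-1 fin).
  by apply: ereal_inf_lbound; exists lam, a.
(* Positivity and finiteness of [N] let the strict comparison of constants survive multiplication by
   [N]. *)
have N0 : (0 < N)%E.
  have [phi tphi fphi] := f_neq0.
  have [|M M0 HM] := @pairing_le_cost R p q phi _ q_ge1 tphi; first by rewrite p_half.
  pose c := M^-1 * `|f phi| `^ p.
  have c0 : 0 < c by rewrite mulr_gt0 ?invr_gt0 ?powR_gt0 ?normr_gt0.
  apply: (@lt_le_trans _ _ (c `^ p^-1)%:E); first by rewrite lte_fin powR_gt0.
  apply: le_ereal_inf_tmp => _ [lam [a [dec ->]]].
  rewrite -poweR_EFin; apply: mono; first by rewrite lee_fin ltW.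
  by rewrite /c EFinM lee_pdivrMl//; exact: HM dec.
rewrite LnormRpos_EFin// -/I.
(* The infimum is taken with the fixed constant [K]; strictness then comes from K < 1/(1 - s). *)
apply: (@le_lt_trans _ _ ((K `^ p^-1)%:E * N)%E).
  rewrite -lee_pdivrMl ?powR_gt0//.
  apply: le_ereal_inf_tmp => _ [lam [a [dec ->]]].
  rewrite lee_pdivrMl ?powR_gt0// -poweR_EFin -poweRM ?lee_fin ?(ltW K0)//.
  by apply: mono => //; exact: IK dec.
rewrite lte_pmul2r//; last by rewrite gt0_fin_numE.
have s1' : 0 < 1 - s by rewrite subr_gt0.
rewrite lte_fin !div1r -powRN -[- p^-1]mulN1r powRrM powR_inv1 ?(ltW s1')//.
apply: gt0_ltr_powR; rewrite ?nnegrE ?invr_gt0 ?invr_ge0 ?(ltW K0) ?(ltW s1')//.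
exact: hardy_atom_const_lt.
Qed.
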